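(* In the setting described in the context (and after reducing $\varepsilon>0$ and the open sets $U^l_i$ if necessary), every holonomy map $\mathrm{hol}^l_i:U^l_i\subset\Sigma^u_i\to\Sigma^s_j$, $j=j(l)$, carries the leaves $L^{u,c}_i$, $c\in(-\varepsilon,\varepsilon)$, onto segments $F^{s,c}_j$ of the local stable manifolds $W^{s,c}_j$ (that is, segments of $W^{s,c}_j\cap\Sigma^s_j$, for the same parameter $c$).
   Context: Prepared triples. $M$ is a $3$-dimensional Riemannian manifold. A $C^3$-triple $(U,X,Y)$ consists of a relatively compact open set $U\subset M$ and two complete commuting vector fields $X,Y$ of class $C^3$ on $M$ with $\mathrm{Zero}(Y)\cap U=\mathrm{Zero}(X)\cap\partial U=\emptyset$. Let $\Pi=Y^\perp$ and write $X=N+\mu Y$ on $\overline U$ with $N$ tangent to $\Pi$ and $\mu:\overline U\to\mathbb R$. Put $K=\mathrm{Zero}(X)\cap U$ and $K_c=\mathrm{Zero}(X-cY)\cap\overline U\subset\mu^{-1}(c)$. The triple is prepared if for some $\varepsilon>0$: (1) $\overline U$ is trivially foliated by the level sets $\mu^{-1}(c)$, $c\in[-\varepsilon,\varepsilon]$, all diffeomorphic to the same compact connected surface, possibly with boundary; (2) $Y$ is nowhere orthogonal to the level sets; (3) $0$ is a continuity point of $c\mapsto K_c$ in the Hausdorff topology (for every neighbourhood $V$ of $K_0$, $K_c\subset V$ for $|c|$ small, and for every open $V$ meeting $K_0$, $K_c\cap V\ne\emptyset$ for $|c|$ small); (4) $K_c\cap\partial\mu^{-1}(c)=\emptyset$ for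 all $c$. $Y'$ is the orthogonal projection of $Y$ on the level sets of $\mu$; $\mathrm{Per}$ denotes the set of periodic points, $\alpha,\omega$ the limit sets. Setting. $(U,X,Y)$ is a $C^3$-prepared triple with $Y$ transversally oriented and the level sets of $\mu$ oriented, such that $Y'|_{\mu^{-1}(0)}$ is Morse–Smale and for every periodic orbit $\gamma$ of $Y'$ in $K$ there is $x\in K\setminus\mathrm{Per}(Y')$ with $\omega_{Y'}(x)=\gamma$ or $\alpha_{Y'}(x)=\gamma$. The sets $K_c$, $|c|<\varepsilon$, are connected. The stable (resp. unstable) periodic orbits of $Y'|_{\mu^{-1}(0)}$ in $K$, denoted $\gamma^{s}_j$ (resp. $\gamma^{u}_i$), have $C^3$ continuations $\gamma^{s,c}_j$ (resp. $\gamma^{u,c}_i$), $|c|<\varepsilon$, which are stable (resp. unstable) periodic orbits of $Y'|_{\mu^{-1}(c)}$; they are contained in $K_c$, hence are periodic orbits of $Y$, and $K_c$ consists of these orbits and of $Y$-orbits with $\alpha$-limit some $\gamma^{u,c}_i$ and $\omega$-limit some $\gamma^{s,c}_j$; there is such a connection from $\gamma^{u,c}_i$ to $\gamma^{s,c}_j$ if and only if there is one from $\gamma^u_i$ to $\gamma^s_j$. Let $\mathcal A^s_j=\bigcup_c\gamma^{s,c}_j$ and $\mathcal A^u_i=\bigcup_c\gamma^{u,c}_i$ (embedded annuli). Each $\gamma^{s,c}_j$ (resp. $\gamma^{u,c}_i$) has for the flow of $Y$ a local stable manifold $W^{s,c}_j$ (resp. local unstable manifold $W^{u,c}_i$), an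 embedded open annulus; for fixed $j$ (resp. $i$) these annuli, $|c|<\varepsilon$, foliate an open neighbourhood of $\mathcal A^s_j$ (resp. $\mathcal A^u_i$). $\Sigma^s_j$ (resp. $\Sigma^u_i$) is a small $2$-dimensional section transverse to $\mathcal A^s_j$ (resp. $\mathcal A^u_i$), everywhere orthogonal to $Y$ (the metric being chosen so near these sections), trivially foliated by its intersections with the $W^{s,c}_j$ (resp. $W^{u,c}_i$). Fundamental domains. Let $P^u_i$ be the first return map of $Y$ to $\Sigma^u_i$. In each of the (one or two) connected components of $(\Sigma^u_i\cap W^{u,0}_i)\setminus\mathrm{Per}(Y)$ that meet $K$, choose a point of $K$, say $x_i$, and take the half-open segment $(P^u_i(x_i),x_i]$; $J_i$ is the union of these segments. $\{U^l_i\}_{l}$ is a finite family of small open subsets of $\Sigma^u_i$, each meeting $J_i\cap K$ and together covering $J_i\cap K$, such that for each $l$ there is a holonomy map along the flow of $Y$, $\mathrm{hol}^l_i:U^l_i\to\Sigma^s_j$ for some $j=j(l)$ (sending $x$ to $Y_{\tau(x)}(x)\in\Sigma^s_j$), and such that $U^l_i$ is foliated by the segments $L^{u,c}_i=W^{u,c}_i\cap U^l_i$, $c\in(-\varepsilon,\varepsilon)$. *)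

(* Defs.v *)
From mathcomp Require Import all_boot all_order all_algebra.
From mathcomp Require Import all_classical all_reals all_analysis.
Import Order.TTheory GRing.Theory Num.Theory numFieldNormedType.Exports.

Set Implicit Arguments.
Unset Strict Implicit.
Unset Printing Implicit Defensive.

Local Open Scope classical_set_scope.
Local Open Scope ring_scope.

(* [f] is of class C^k on [A]; meaningful for open [A]. *)
Fixpoint Ck_on (R : realType) (V : normedModType R) (n k : nat)
    (A : set 'rV[R]_n) (f : 'rV[R]_n -> V) : Prop :=
  if k is k'.+1 then
    (forall x, A x -> differentiable f x) /\
    (forall i : 'I_n, Ck_on k' A (fun x => 'D_(delta_mx 0 i) f x))
  else forall x, A x -> {for x, continuous f}.

Record chart (R : realType) (T : Type) (n : nat) := Chart {
  dom : set T;
  coord : T -> 'rV[R]_n;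
  icoord : 'rV[R]_n -> T }.

Definition is_chart (R : realType) (T : topologicalType) (n : nat)
    (a : chart R T n) : Prop :=
  [/\ open (dom a), open (coord a @` dom a),
      (forall p, dom a p -> icoord a (coord a p) = p),
      (forall p, dom a p -> {for p, continuous (coord a)}) &
      (forall x, (coord a @` dom a) x -> {for x, continuous (icoord a)})].

Definition transition_Ck (R : realType) (T : Type) (n k : nat)
    (a b : chart R T n) : Prop :=
  Ck_on k (coord a @` (dom a `&` dom b)) (coord b \o icoord a).

(* Smooth manifolds without boundary. [chart_at p] is a preferred chart
   around [p]: tangent vectors at [p] are represented by their components in
   [chart_at p], so that the tangent space at every point is 'rV[R]_n. *)
Record manifold (R : realType) (n : nat) := Manifold {
  carrier :> topologicalType;
  atlas : set (chart R carrier n);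
  chart_at : carrier -> chart R carrier n;
  manifold_hausdorff : hausdorff_space carrier;
  manifold_second_countable : @second_countable carrier;
  atlas_charts : forall a, atlas a -> is_chart a;
  atlas_smooth : forall a b k, atlas a -> atlas b -> transition_Ck k a b;
  chart_at_atlas : forall p, atlas (chart_at p);
  chart_at_dom : forall p, dom (chart_at p) p }.

Definition rV_atlas (R : realType) (n : nat) : set (chart R 'rV[R]_n n) :=
  [set Chart setT id id].

Definition R_atlas (R : realType) : set (chart R R 1) :=
  [set Chart setT (fun t => const_mx t) (fun v => v 0 0)].

Definition prod_chart (R : realType) (T T' : Type) (n m : nat)
    (a : chart R T n) (b : chart R T' m) : chart R (T * T') (n + m) :=
  Chart (dom a `*` dom b) (fun p => row_mx (coord a p.1) (coord b p.2))
    (fun v => (icoord a (lsubmx v), icoord b (rsubmx v))).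

Definition prod_atlas (R : realType) (T T' : Type) (n m : nat)
    (A : set (chart R T n)) (B : set (chart R T' m)) :
    set (chart R (T * T') (n + m)) :=
  [set c | exists a b, [/\ A a, B b & c = prod_chart a b]].

(* [f] restricted to the arbitrary subset [D] is of class C^k: in charts it
   extends locally to a C^k map between open subsets of Euclidean spaces.
   This is the usual convention on manifolds with boundary or corners. *)
Definition Ck_map (R : realType) (T T' : Type) (n m k : nat)
    (A : set (chart R T n)) (B : set (chart R T' m)) (D : set T)
    (f : T -> T') : Prop :=
  forall p, D p -> exists a b, [/\ A a, B b, dom a p, dom b (f p) &
    exists (V : set 'rV[R]_n) (h : 'rV[R]_n -> 'rV[R]_m),
      [/\ open V, V (coord a p), Ck_on k V h &
      forall q, D q -> dom a q -> V (coord a q) ->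
        dom b (f q) /\ coord b (f q) = h (coord a q)]].

Section Tensors.
Context (R : realType) (n : nat) (M : manifold R n).
Implicit Types (a : chart R M n) (p : M) (v w : 'rV[R]_n).

(* components in [a] of the tangent vector [v] at [p] *)
Definition push a p v : 'rV[R]_n :=
  'd (coord a \o icoord (chart_at p)) (coord (chart_at p) p) v.

(* tangent vector at [p] with components [v] in [a] *)
Definition pull a p v : 'rV[R]_n :=
  'd (coord (chart_at p) \o icoord a) (coord a p) v.

Definition field_in a (V : M -> 'rV[R]_n) (x : 'rV[R]_n) : 'rV[R]_n :=
  push a (icoord a x) (V (icoord a x)).

Definition Ck_field k (V : M -> 'rV[R]_n) : Prop :=
  forall a, atlas a -> Ck_on k (coord a @` dom a) (field_in a V).

Definition bil (B : 'M[R]_n) v w : R := (v *m B *m w^T) 0 0.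

Definition form_in a (B : M -> 'M[R]_n) (i j : 'I_n) (x : 'rV[R]_n) : R :=
  bil (B (icoord a x)) (pull a (icoord a x) (delta_mx 0 i))
    (pull a (icoord a x) (delta_mx 0 j)).

Definition Ck_form k (A : set M) (B : M -> 'M[R]_n) : Prop :=
  forall a i j, atlas a ->
    Ck_on k (coord a @` (dom a `&` A)) (form_in a B i j).

Definition riemannian (g : M -> 'M[R]_n) : Prop :=
  [/\ forall p, (g p)^T = g p,
      forall p v, v != 0 -> 0 < bil (g p) v v &
      forall k, Ck_form k setT g].

Definition commuting (V W : M -> 'rV[R]_n) : Prop :=
  forall a x, atlas a -> (coord a @` dom a) x ->
    'd (field_in a W) x (field_in a V x) = 'd (field_in a V) x (field_in a W x).

Definition differential (f : M -> R) p v : R :=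
  'd (f \o icoord (chart_at p)) (coord (chart_at p) p) v.

Definition gradient (g : M -> 'M[R]_n) (f : M -> R) p : 'rV[R]_n :=
  (\row_i differential f p (delta_mx 0 i)) *m invmx (g p).

Definition velocity (s : R -> M) (t : R) : 'rV[R]_n :=
  'D_1 (coord (chart_at (s t)) \o s) t.

Definition jacobian m (e : 'rV[R]_m -> M) (z : 'rV[R]_m) : 'M[R]_(m, n) :=
  \matrix_(i < m) 'd (coord (chart_at (e z)) \o e) z (delta_mx 0 i : 'rV[R]_m).

(* an orientation on [A] of the plane field [E], given by a continuous 2-form
   which does not degenerate on [E] *)
Definition orientable_on (E : M -> set 'rV[R]_n) (A : set M) : Prop :=
  exists B : M -> 'M[R]_n, Ck_form 0 A B /\
    forall p, A p -> (B p)^T = - B p /\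
      forall v w, E p v -> E p w -> row_free (col_mx v w) ->
        bil (B p) v w != 0.

Definition integral_curve (V : M -> 'rV[R]_n) (I : set R) (A : set M)
    (s : R -> M) : Prop :=
  [/\ {within I, continuous s}, s @` I `<=` A &
      forall t, I^° t ->
        is_derive (t : R) (1 : R) (coord (chart_at (s t)) \o s) (V (s t))].

Definition is_flow (V : M -> 'rV[R]_n) (phi : R -> M -> M) : Prop :=
  forall p, phi 0 p = p /\ integral_curve V setT setT (phi ^~ p).

Definition complete_field (V : M -> 'rV[R]_n) : Prop :=
  exists phi, is_flow V phi.

Definition omega_limit (s : R -> M) : set M :=
  \bigcap_(T in [set: R]) closure (s @` [set t | T <= t]).

Definition alpha_limit (s : R -> M) : set M :=
  \bigcap_(T in [set: R]) closure (s @` [set t | t <= T]).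

(* [V] need not be complete in [A] (orbits may leave through the boundary), so
   that limit sets are defined along half-orbits contained in [A]. *)
Definition omega_is (V : M -> 'rV[R]_n) (A : set M) p (L : set M) : Prop :=
  exists s, [/\ integral_curve V [set t | 0 <= t] A s, s 0 = p &
    omega_limit s = L].

Definition alpha_is (V : M -> 'rV[R]_n) (A : set M) p (L : set M) : Prop :=
  exists s, [/\ integral_curve V [set t | t <= 0] A s, s 0 = p &
    alpha_limit s = L].

Definition periodic_param (V : M -> 'rV[R]_n) (A gamma : set M)
    (s : R -> M) (T : R) : Prop :=
  [/\ 0 < T, integral_curve V setT A s, forall t, s (t + T) = s t,
      forall t, 0 < t -> t < T -> s t <> s 0 & gamma = range s].

Definition periodic_orbit (V : M -> 'rV[R]_n) (A gamma : set M) : Prop :=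
  exists s T, periodic_param V A gamma s T.

Definition periodic_points (V : M -> 'rV[R]_n) (A : set M) : set M :=
  [set p | exists gamma, periodic_orbit V A gamma /\ gamma p].

(* [lambda] is the derivative at its fixed point of the first return map [P]
   of [V] to a C^1 arc [s] in the surface [S], transverse at [s 0] to the
   periodic orbit [gamma]; [tau] is the return time. *)
Definition multiplier (V : M -> 'rV[R]_n) (S gamma : set M) (lambda : R) :
    Prop :=
  exists (c : R -> M) (T : R) (s : R -> M) (P tau : R -> R),
  [/\ periodic_param V S gamma c T, [/\ s 0 = c 0, P 0 = 0 & tau 0 = T],
      Ck_map 1 (@R_atlas R) (@atlas R n M) [set u | `|u| < 1] s /\
        row_free (col_mx (velocity s 0) (V (s 0))),
      {for 0, continuous tau} /\ is_derive (0 : R) (1 : R) P lambda &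
      \forall u \near (0 : R), S (s u) /\
        exists c', [/\ integral_curve V [set t | 0 <= t <= tau u] S c',
          c' 0 = s u & c' (tau u) = s (P u)]].

Definition hyperbolic_orbit V S gamma : Prop :=
  exists lambda, multiplier V S gamma lambda /\ `|lambda| != 1.

Definition stable_orbit V S gamma : Prop :=
  exists lambda, multiplier V S gamma lambda /\ `|lambda| < 1.

Definition unstable_orbit V S gamma : Prop :=
  exists lambda, multiplier V S gamma lambda /\ 1 < `|lambda|.

Definition nonwandering (V : M -> 'rV[R]_n) (S : set M) p : Prop :=
  S p /\ forall (O : set M) (T : R), nbhs p O ->
    exists s t, [/\ T <= t, 0 <= t,
      integral_curve V [set r | 0 <= r <= t] S s, O (s 0) & O (s t)].

(* Morse-Smale vector fields without zeros on an oriented compact surface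
   (zeros are excluded where this is used: the field Y' has none, as Y is
   nowhere orthogonal to the level sets). There are then no saddles, and
   hyperbolic periodic orbits are sinks or sources, so that the transversality
   of stable and unstable manifolds holds trivially. *)
Definition morse_smale (V : M -> 'rV[R]_n) (S : set M) : Prop :=
  [/\ forall p, S p -> V p != 0,
      finite_set [set gamma | periodic_orbit V S gamma],
      forall gamma, periodic_orbit V S gamma -> hyperbolic_orbit V S gamma &
      nonwandering V S `<=` periodic_points V S].

Definition top_embedding (T T' : topologicalType) (D : set T) (f : T -> T') :
    Prop :=
  [/\ {within D, continuous f}, set_inj D f &
      forall O, open O -> exists2 O', open O' & f @` (O `&` D) = O' `&` f @` D].

Definition C3_embedding m (D : set 'rV[R]_m) (e : 'rV[R]_m -> M) : Prop :=
  [/\ Ck_map 3 (@rV_atlas R m) (@atlas R n M) D e,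
      forall z, D z -> row_free (jacobian e z) & top_embedding D e].

(* the punctured plane is the model of the open annulus *)
Definition open_annulus (W : set M) : Prop :=
  exists e : 'rV[R]_2 -> M,
    C3_embedding [set z | z != 0] e /\ W = e @` [set z | z != 0].

(* Parametrized annulus: an embedding of ]-eps, eps[ * R/Z, where a point
   [z : 'rV[R]_2] has first coordinate c in ]-eps, eps[ and second coordinate
   an angle, of period 1. *)
Definition strip (eps : R) : set 'rV[R]_2 := [set z | `|z 0 0| < eps].

Definition C3_annulus (eps : R) (G : 'rV[R]_2 -> M) : Prop :=
  [/\ Ck_map 3 (@rV_atlas R 2) (@atlas R n M) (strip eps) G,
      forall z, strip eps z -> row_free (jacobian G z),
      forall z z', strip eps z -> strip eps z' ->
        (G z = G z' <->
         z 0 0 = z' 0 0 /\ exists k : int, z 0 1 - z' 0 1 = k%:~R) &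
      forall O, open O -> exists2 O', open O' &
        G @` (O `&` strip eps) = O' `&` G @` strip eps].

Definition circle (G : 'rV[R]_2 -> M) (c : R) : set M :=
  G @` [set z : 'rV[R]_2 | z 0 0 = c].

(* The leaves of the product foliation of [A] are the open arcs [A `&` L c]. *)
Definition trivially_foliated (eps : R) (L : R -> set M) (A : set M) : Prop :=
  exists h : R * R -> M,
    [/\ top_embedding [set u | `|u.1| < 1 /\ `|u.2| < eps] h,
        A = h @` [set u | `|u.1| < 1 /\ `|u.2| < eps] &
        forall c, `|c| < eps -> A `&` L c = h @` [set u | `|u.1| < 1 /\ u.2 = c]].

Definition segment_of (l C : set M) : Prop :=
  [/\ C `<=` l, connected C & exists p q, [/\ C p, C q & p <> q]].

(* In an arc, the segment [p, q] is the least connected set containing p, q. *)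
Definition half_open_segment (l : set M) p q : set M :=
  [set z | [/\ l z, z <> p &
    forall C, C `<=` l -> connected C -> C p -> C q -> C z]].

Definition Ck_chart k a : Prop :=
  is_chart a /\
  forall b, atlas b -> transition_Ck k a b /\ transition_Ck k b a.

Definition periodic_family N (G : 'I_N -> 'rV[R]_2 -> M) (eps : R)
    (stab : set M -> set M -> Prop) (K : R -> set M) (S : R -> set M) : Prop :=
  [/\ forall j, C3_annulus eps (G j),
      injective (fun j => circle (G j) 0),
      forall gamma, (stab (S 0) gamma /\ gamma `<=` K 0) <->
        exists j, gamma = circle (G j) 0 &
      forall j c, `|c| < eps ->
        stab (S c) (circle (G j) c) /\ circle (G j) c `<=` K c].

Definition reverse (phi : R -> M -> M) (t : R) p : M := phi (- t) p.

Definition converges_to (phi : R -> M -> M) p (gamma : set M) : Prop :=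
  forall O, open O -> gamma `<=` O ->
    exists T, forall t, T <= t -> O (phi t p).

Definition local_stable (phi : R -> M -> M) (gamma W : set M) : Prop :=
  [/\ open_annulus W, gamma `<=` W &
      exists V, [/\ open V, gamma `<=` V &
        W = [set p | (forall t, 0 <= t -> V (phi t p)) /\
                     converges_to phi p gamma]]].

Definition first_return (phi : R -> M -> M) (S : set M) p q : Prop :=
  exists t, [/\ 0 < t, q = phi t p, S q &
    forall r, 0 < r -> r < t -> ~ S (phi r p)].

End Tensors.

Section Prepared.
Context (R : realType) (M : manifold R 3).

Definition surface_interior_point (S : set M) (p : M) : Prop :=
  exists a, [/\ Ck_chart 3 a, dom a p &
    S `&` dom a = [set q | dom a q /\ coord a q 0 2 = 0]].

Definition surface_boundary_point (S : set M) (p : M) : Prop :=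
  exists a, [/\ Ck_chart 3 a, dom a p, coord a p 0 1 = 0 &
    S `&` dom a =
      [set q | [/\ dom a q, coord a q 0 2 = 0 & 0 <= coord a q 0 1]]].

Definition surface (S : set M) : Prop :=
  forall p, S p -> surface_interior_point S p \/ surface_boundary_point S p.

Definition surface_boundary (S : set M) : set M :=
  [set p | S p /\ surface_boundary_point S p].

(* Each point of [O] has a foliated chart whose plaques lie at height c in the
   leaf [L c]; since there is one leaf for each c, the parameter of the leaf can
   serve as transverse coordinate. Transversally, charts are only continuous. *)
Definition foliates (eps : R) (L : R -> set M) (O : set M) : Prop :=
  [/\ open O, O = \bigcup_(c in [set c | `|c| < eps]) L c &
      forall p, O p -> exists V (h : M -> 'rV[R]_3),
        [/\ open V, V p, V `<=` O, top_embedding V h /\ open (h @` V) &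
            forall q c, V q -> `|c| < eps -> (L c q <-> h q 0 2 = c)]].

Section Triple.
Context (g : M -> 'M[R]_3) (U : set M) (X Y : M -> 'rV[R]_3).

Definition C3_triple : Prop :=
  [/\ open U, compact (closure U),
      [/\ Ck_field 3 X, Ck_field 3 Y, complete_field X, complete_field Y &
          commuting X Y],
      forall p, U p -> Y p != 0 &
      forall p, closure U p -> ~ U p -> X p != 0].

(* X = N + mu Y with N orthogonal to Y *)
Definition mu (p : M) : R := bil (g p) (X p) (Y p) / bil (g p) (Y p) (Y p).

Definition level (c : R) : set M := [set p | closure U p /\ mu p = c].

Definition level_tangent (p : M) : set 'rV[R]_3 :=
  [set v | differential mu p v = 0].

Definition Kc (c : R) : set M := [set p | closure U p /\ X p = c *: Y p].

Definition K : set M := [set p | U p /\ X p = 0].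

Definition Yproj (p : M) : 'rV[R]_3 :=
  let N := gradient g mu p in
  Y p - (bil (g p) (Y p) N / bil (g p) N N) *: N.

Definition normal_plane (p : M) : set 'rV[R]_3 :=
  [set v | bil (g p) v (Y p) = 0].

(* [Phi] is a C^3 diffeomorphism of level 0 * [-eps, eps] onto [closure U],
   with inverse (pi, mu) *)
Definition trivial_levels (eps : R) : Prop :=
  exists (Phi : M * R -> M) (pi : M -> M),
  let dom_Phi := level 0 `*` [set c : R | `|c| <= eps] in
  [/\ Ck_map 3 (prod_atlas (@atlas R 3 M) (@R_atlas R)) (@atlas R 3 M)
        dom_Phi Phi,
      Ck_map 3 (@atlas R 3 M) (@atlas R 3 M) (closure U) pi,
      forall u, dom_Phi u ->
        [/\ closure U (Phi u), pi (Phi u) = u.1 & mu (Phi u) = u.2] &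
      forall p, closure U p ->
        [/\ level 0 (pi p), `|mu p| <= eps & Phi (pi p, mu p) = p]].

Definition prepared (eps : R) : Prop :=
  [/\ trivial_levels eps /\
        (forall c, `|c| <= eps ->
          [/\ surface (level c), compact (level c) & connected (level c)]),
      (forall p, closure U p ->
        exists2 v, level_tangent p v & bil (g p) (Y p) v != 0),
      (forall V, open V -> Kc 0 `<=` V -> \forall c \near (0 : R), Kc c `<=` V) /\
        (forall V, open V -> Kc 0 `&` V !=set0 ->
          \forall c \near (0 : R), Kc c `&` V !=set0) &
      forall c, `|c| <= eps -> Kc c `&` surface_boundary (level c) = set0].

(* small section [S] orthogonal to Y, transverse to the annulus parametrized by
   [G] and crossing each of its circles once *)
Definition cross_section (eps : R) (G : 'rV[R]_2 -> M) (S : set M) : Prop :=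
  (exists e : 'rV[R]_2 -> M,
    [/\ C3_embedding setT e, S = range e,
        forall z i, bil (g (e z)) (row i (jacobian e z)) (Y (e z)) = 0 &
        forall z z', strip eps z -> G z = e z' ->
          row_full (col_mx (jacobian G z) (jacobian e z'))]) /\
  forall c, `|c| < eps -> exists p, S `&` circle G c = [set p].

(* [W j c]: local stable manifold of [circle (G j) c] for [phi], [S j]: section.
   The reversed flow gives local unstable manifolds. *)
Definition stable_system (phi : R -> M -> M) (eps : R) N
    (G : 'I_N -> 'rV[R]_2 -> M) (W : 'I_N -> R -> set M) (S : 'I_N -> set M) :
    Prop :=
  forall j,
  [/\ forall c, `|c| < eps -> local_stable phi (circle (G j) c) (W j c),
      exists2 O, foliates eps (W j) O & G j @` strip eps `<=` O,
      cross_section eps (G j) (S j) & trivially_foliated eps (W j) (S j)].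

(* [B] contains one point of [K] in each component of
   (S `&` W 0) \ Per(Y) meeting [K]; the return of that point lies on the leaf *)
Definition base_points (phi : R -> M -> M) (W : R -> set M) (S B : set M) :
    Prop :=
  let l := S `&` W 0 in
  let D := l `\` periodic_points Y setT in
  [/\ B `<=` D `&` K,
      forall y, (D `&` K) y ->
        exists b, B `&` connected_component D y = [set b] &
      forall b, B b -> exists2 q, first_return phi S b q & l q].

Definition fundamental_domain (phi : R -> M -> M) (W : R -> set M)
    (S B : set M) : set M :=
  [set z | exists b q, [/\ B b, first_return phi S b q &
    half_open_segment (S `&` W 0) q b z]].

Definition covering_family (eps : R) (W : R -> set M) (S J : set M) N
    (V : 'I_N -> set M) : Prop :=
  [/\ forall l, exists2 O, open O & V l = O `&` S,
      forall l, V l `&` (J `&` K) !=set0,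
      J `&` K `<=` \bigcup_l V l,
      forall l, V l `<=` \bigcup_(c in [set c | `|c| < eps]) W c &
      forall l c, `|c| < eps -> segment_of (S `&` W c) (V l `&` W c)].

End Triple.
End Prepared.

(* Main.v *)
(* Let [psi] be the flow of [X]; it commutes with the flow [phi] of [Y]. A
   periodic orbit of [Y] on which [X = c Y] is invariant under both flows, hence
   so are, locally, its stable and unstable manifolds. A point of such a manifold
   at which [X = c' Y] has [c' = c], because the closed set where [X = c' Y] is
   [phi]-invariant and thus meets the periodic orbit.

   So on the arc [V] of the leaf [c] of the unstable foliation, the parameter of
   the stable leaf reached by the holonomy equals [c] at each point where [X] and
   [Y] are collinear. Near a point where they are not, the arc contains the
   nonconstant projection along [phi] of a piece of [psi]-orbit, on which this
   parameter is constant. Since only countably many disjoint pieces fit in an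
   arc, the intermediate value theorem forces the parameter to be constant, equal
   to [c] as soon as the arc contains one collinear point; for small [c] it does,
   by the continuity of [c |-> K_c] at [0]. *)

From HB Require Import structures.
Require Import Defs.
From mathcomp Require Import all_boot all_order all_algebra.
From mathcomp Require Import all_classical all_reals all_analysis.
From mathcomp Require Import lra ring.
Import Order.TTheory GRing.Theory Num.Theory numFieldNormedType.Exports.

Set Implicit Arguments.
Unset Strict Implicit.
Unset Printing Implicit Defensive.

Local Open Scope classical_set_scope.
Local Open Scope ring_scope.
Local Notation coord := Defs.coord.
Local Notation jacobian := Defs.jacobian.

(** * Estimates in Euclidean space *)

(** Three weaknesses of the data shape the proof. A flow is only a choice of one complete integral
    curve through each point: uniqueness, the group law, joint continuity and commutation are all
    derived here, from estimates over short times inside one chart, spread to all times by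
    connectedness of the line. A local stable manifold is cut out by an arbitrary neighbourhood of
    its orbit, so it is invariant under both flows only for short times, which depend on the point;
    for this reason only short pieces of orbits ever enter the argument. Finally the leaves depend
    continuously, not smoothly, on [c], and the time of the holonomy is only continuous. The leaf
    parameter along an arc therefore cannot be differentiated, and a cardinality argument stands
    where one would like to see a derivative vanish. For the same reason the time at which a flow
    line crosses a section is obtained only as a continuous function, and a constant projection has
    to be excluded by first order estimates on minors. *)

Section Calculus.
Context {R : realType}.

Lemma is_derive_comp (V W : normedModType R) (c : R -> V) (F : V -> W) (t : R) (v : V) :
  is_derive (t : R) (1 : R) c v -> differentiable F (c t) ->
  is_derive (t : R) (1 : R) (F \o c) ('d F (c t) v).
Proof.
move=> [dc <-] dF; have dc' : differentiable c t by apply/derivable1_diffP.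
have dFc : differentiable (F \o c) t by exact: differentiable_comp.
split; first by apply/derivable1_diffP.
by rewrite (deriveE _ dFc) (deriveE _ dc') diff_comp.
Qed.

Lemma is_derive_coord n (c : R -> 'rV[R]_n) t v i :
  is_derive (t : R) (1 : R) c v -> is_derive (t : R) (1 : R) (fun s => c s 0 i) (v 0 i).
Proof.
move=> [dc <-]; split; first exact: (derivable_mxP _ _ _).1.
by rewrite derive_mx// mxE.
Qed.

Lemma is_derive_littleo (V : normedModType R) (c : R -> V) (t : R) (v : V) (e : R) :
  is_derive (t : R) (1 : R) c v -> 0 < e ->
  \forall h \near 0, `|c (t + h) - c t - h *: v| <= e * `|h|.
Proof.
move=> [dc <-] e0.
have /derivable1_diffP/diff_locally/eqaddoP := dc.
move=> /(_ e e0); apply: filterS => h.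
rewrite [X in `|X| <= _ -> _](_ : _ = c (t + h) - c t - h *: 'D_1 c t)//.
rewrite -[LHS]/(c (h + t) - (c t + 'd c t h)) opprD addrA (addrC h).
rewrite deriveE; last exact/derivable1_diffP.
by rewrite -linearZ/= [h *: 1]mulr1.
Qed.

Lemma is_derive_from_littleo (V : normedModType R) (c : R -> V) (t : R) (v : V) :
  (forall e, 0 < e ->
    \forall h \near 0, `|c (t + h) - c t - h *: v| <= e * `|h|) ->
  is_derive (t : R) (1 : R) c v.
Proof.
move=> H.
have cvg : (fun h : R => h^-1 *: ((c \o shift t) (h *: (1:R)) - c t)) @ 0^' --> v.
  apply/cvgrPdist_le => e e0.
  have := H e e0.
  rewrite /dnbhs /within /=.
  apply: filterS => h Hh h0.
  rewrite distrC -[X in _ - X]scale1r -[in X in _ - X](mulVf h0) -scalerA.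
  rewrite -scalerBr /= [h *: 1]mulr1 (addrC h) normrZ normfV ler_pdivrMl ?normr_gt0// mulrC.
  exact: Hh.
split; first by apply/cvg_ex; exists v.
exact: cvg_lim.
Qed.

Lemma is_derive_line (V : normedModType R) (t : R) (x v : V) :
  is_derive (t : R) (1 : R) (fun s : R => x + s *: v) v.
Proof.
apply: is_derive_from_littleo => e e0; near=> h.
have -> : x + (t + h) *: v - (x + t *: v) - h *: v = 0.
  by rewrite scalerDl addrA [X in X - _]addrAC subrr add0r subrr.
by rewrite normr0 mulr_ge0// ltW.
Unshelve. all: by end_near. Qed.

(** The norm of a row vector is the maximum of its entries, so the scalar mean value theorem on each
    entry loses no constant. *)
Lemma mvt_rV n (c dc : R -> 'rV[R]_n) (a b K : R) : a <= b -> 0 <= K ->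
  (forall t, a <= t <= b -> is_derive (t : R) (1 : R) c (dc t)) ->
  (forall t, a <= t <= b -> `|dc t| <= K) ->
  `|c b - c a| <= K * (b - a).
Proof.
move=> ab K0 H1 H2.
have B0 : 0 <= K * (b - a) by rewrite mulr_ge0// subr_ge0.
rewrite [leLHS]mx_normrE; apply/bigmax_leP; split => // -[i j] _ /=.
rewrite (ord1 i) !mxE.
have D t : a <= t <= b -> is_derive (t : R) (1 : R) (fun s => c s 0 j) (dc t 0 j).
  by move=> /H1; exact: is_derive_coord.
have [||s sab ->] := @MVT_segment R (fun s => c s 0 j) (fun s => dc s 0 j) a b ab.
- by move=> x; rewrite in_itv/= => /andP[/ltW ? /ltW ?]; apply: D; apply/andP.
- apply: derivable_within_continuous => x; rewrite in_itv/= => xab.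
  by have [] := D x xab.
move: sab; rewrite in_itv /= => /H2 sK.
rewrite normrM (ger0_norm (_ : 0 <= b - a)) ?subr_ge0//.
apply: ler_wpM2r; first by rewrite subr_ge0.
apply: le_trans sK; rewrite [leRHS]mx_normrE.
exact: (@le_bigmax _ _ _ 0 (fun ij => `|dc s ij.1 ij.2|) (0, j)).
Qed.

Lemma mvt_rV_abs n (c dc : R -> 'rV[R]_n) (a e t K : R) : `|t - a| <= e -> 0 <= K ->
  (forall t, `|t - a| <= e -> is_derive (t : R) (1 : R) c (dc t)) ->
  (forall t, `|t - a| <= e -> `|dc t| <= K) ->
  `|c t - c a| <= K * `|t - a|.
Proof.
move=> te K0 H1 H2; have [at_|ta] := leP a t.
  rewrite (ger0_norm (_ : 0 <= t - a)) ?subr_ge0//.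
  apply: (mvt_rV (dc := dc)) => // s /andP[s1 s2]; [apply: H1|apply: H2];
  rewrite ger0_norm ?subr_ge0//; apply: le_trans te;
  by rewrite (ger0_norm (_ : 0 <= t - a)) ?subr_ge0// lerB.
rewrite distrC (distrC t).
rewrite (ger0_norm (_ : 0 <= a - t)) ?subr_ge0 ?(ltW ta)//.
apply: (mvt_rV (dc := dc) (ltW ta)) => // s /andP[s1 s2]; [apply: H1|apply: H2];
  rewrite distrC ger0_norm ?subr_ge0//; apply: le_trans te;
  by rewrite distrC (ger0_norm (_ : 0 <= a - t)) ?subr_ge0 ?(ltW ta)// lerB.
Qed.

(* Over a time so short that [e * L <= 1/2], the maximum of [`|c|] can be
   absorbed, so that no exponential is needed. *)
Lemma short_gronwall n (c dc : R -> 'rV[R]_n) (a e L eta t : R) :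
  `|t - a| <= e -> 0 <= L -> 0 <= eta -> e * L <= 2^-1 ->
  (forall t, `|t - a| <= e -> is_derive (t : R) (1 : R) c (dc t)) ->
  (forall t, `|t - a| <= e -> `|dc t| <= L * `|c t| + eta) ->
  `|c t| <= 2 * `|c a| + 2 * e * eta.
Proof.
move=> te L0 eta0 eL H1 H2.
have e0 : 0 <= e by apply: le_trans te.
have cc : {within `[a - e, a + e], continuous (fun s => `|c s|)}.
  apply: continuous_in_subspaceT => s; rewrite inE/= in_itv/= => /andP[s1 s2].
  apply: continuous_comp; last exact: norm_continuous.
  apply: differentiable_continuous; apply/derivable1_diffP.
  by have [] := H1 s _ => //; rewrite ler_distl s1 s2.
have [|m mI mmax] := EVT_max _ cc; first by rewrite lerD2l; lra.
have H s : `|s - a| <= e -> `|c s| <= `|c m|.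
  by rewrite ler_distl => se; apply: mmax; rewrite in_itv.
have me : `|m - a| <= e by rewrite ler_distl; rewrite in_itv in mI.
have K0 : 0 <= L * `|c m| + eta by rewrite addr_ge0 ?mulr_ge0.
have mvt : `|c m - c a| <= (L * `|c m| + eta) * `|m - a|.
  apply: mvt_rV_abs me K0 H1 _ => s se.
  by apply: le_trans (H2 s se) _; rewrite lerD2r ler_wpM2l ?H.
have tri : `|c m| <= `|c m - c a| + `|c a|.
  by rewrite -{1}(subrK (c a) (c m)) ler_normD.
have : `|c m - c a| <= (L * `|c m| + eta) * e.
  by apply: le_trans mvt _; rewrite ler_wpM2l.
have := H t te.
have : e * L * `|c m| <= 2^-1 * `|c m| by rewrite ler_wpM2r.
nra.
Qed.

(* [A] is an arbitrary reference map: [0] gives a Lipschitz bound, ['d f x0]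
   strict differentiability, ['d f x] a Taylor bound. *)
Lemma mvt_ball n m (f : 'rV[R]_n -> 'rV[R]_m) x0 (r K : R)
    (A : {linear 'rV[R]_n -> 'rV[R]_m}) (x y : 'rV[R]_n) :
  (forall z, `|z - x0| < r -> differentiable f z) ->
  `|x - x0| < r -> `|y - x0| < r -> 0 <= K ->
  (forall z, `|z - x0| < r -> `|z - x| <= `|y - x| ->
     `|'d f z (y - x) - A (y - x)| <= K) ->
  `|f y - f x - A (y - x)| <= K.
Proof.
move=> df xr yr K0 H.
pose l (s : R) := x + s *: (y - x).
have lr s : 0 <= s <= 1 -> `|l s - x0| < r.
  move=> /andP[s0 s1].
  have -> : l s - x0 = (1 - s) *: (x - x0) + s *: (y - x0).
    rewrite /l !scalerBr !scalerBl !scale1r.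
    apply/rowP => i; rewrite !mxE; ring.
  apply: le_lt_trans (ler_normD _ _) _; rewrite !normrZ !ger0_norm ?subr_ge0//.
  pose M := Num.max `|x - x0| `|y - x0|.
  have Mr : M < r by rewrite gt_max xr yr.
  have xM : `|x - x0| <= M by rewrite le_max lexx.
  have yM : `|y - x0| <= M by rewrite le_max lexx orbT.
  nra.
have lx s : 0 <= s <= 1 -> `|l s - x| <= `|y - x|.
  move=> /andP[s0 s1]; rewrite /l addrAC subrr add0r normrZ ger0_norm//.
  by rewrite ler_piMl.
have dl s : is_derive (s : R) (1 : R) l (y - x).
  exact: is_derive_line.
have dg s : 0 <= s <= 1 ->
    is_derive (s : R) (1 : R) (fun s => f (l s) - s *: A (y - x))
      ('d f (l s) (y - x) - A (y - x)).
  move=> s01.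
  have D := is_derive_comp (dl s) (df _ (lr s s01)).
  rewrite /comp in D.
  have D2 : is_derive (s : R) (1 : R) (fun s : R => s *: A (y - x)) (A (y - x)).
    have := is_derive_line s 0 (A (y - x)).
    by under eq_fun do rewrite add0r.
  exact: (is_deriveB D D2).
have := mvt_rV ler01 K0 dg
  (fun s s01 => H _ (lr s s01) (lx s s01)).
rewrite /l !scale0r !scale1r !subr0 mulr1 addr0 [x + _]addrC subrK.
by rewrite addrAC.
Qed.

Lemma linear_bound n (W : normedModType R) (A : {linear 'rV[R]_n -> W})
    (v : 'rV[R]_n) :
  `|A v| <= (\sum_(i < n) `|A (delta_mx 0 i)|) * `|v|.
Proof.
rewrite {1}(row_sum_delta v) linear_sum mulr_suml.
apply: le_trans (ler_norm_sum _ _ _) _; apply: ler_sum => i _.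
rewrite linearZ normrZ mulrC ler_wpM2l// [leRHS]mx_normrE.
exact: (@le_bigmax _ _ _ 0 (fun ij => `|v ij.1 ij.2|) (0, i)).
Qed.

Lemma near_ball (V : normedModType R) (x : V) (P : set V) :
  nbhs x P -> \forall r \near 0^'+, forall y, `|y - x| < r -> P y.
Proof.
move=> /nbhs_normP[e /= e0 He]; near=> r => y yr; apply: He => /=.
rewrite distrC; apply: lt_le_trans yr _; near: r.
exact: nbhs_right_le.
Unshelve. all: by end_near. Qed.

(** [Ck_on] controls the partial derivatives one at a time; the differential is recovered from its
    values on the basis. *)
Lemma C1_diff_near n m (f : 'rV[R]_n -> 'rV[R]_m) (A : set 'rV[R]_n) x0
    (e : R) :
  open A -> A x0 -> Ck_on 1 A f -> 0 < e ->
  \forall r \near 0^'+, forall x, `|x - x0| < r ->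
    A x /\ forall v, `|'d f x v - 'd f x0 v| <= e * `|v|.
Proof.
move=> oA Ax0 [df cf] e0.
(* [n.+1] rather than [n] keeps the denominator positive when [n = 0]. *)
have e' : 0 < e / n.+1%:R by rewrite divr_gt0.
have near_D i : \forall z \near x0,
    `|'D_(delta_mx 0 i) f z - 'D_(delta_mx 0 i) f x0| <= e / n.+1%:R.
  have /cvgrPdist_le/(_ _ e') := cf i x0 Ax0.
  by apply: filterS => z; rewrite distrC.
have nA : nbhs x0 A by apply: open_nbhs_nbhs.
have nAD : \forall z \near x0, A z /\
    forall i, `|'D_(delta_mx 0 i) f z - 'D_(delta_mx 0 i) f x0| <= e / n.+1%:R.
  by apply: filterI => //; exact: filter_forall near_D.
apply: filterS (near_ball nAD) => r Hr z /Hr[Az Hz]; split => // v.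
have -> : 'd f z v - 'd f x0 v = ('d f z \- 'd f x0) v by [].
apply: le_trans (linear_bound _ _) _; rewrite ler_wpM2r//.
apply: le_trans (_ : \sum_(i < n) (e / n.+1%:R) <= _).
  apply: ler_sum => i _; have := Hz i.
  by rewrite (deriveE _ (df _ Az)) (deriveE _ (df _ Ax0)).
rewrite sumr_const card_ord -[_ *+ n]mulr_natr mulrAC.
by rewrite ler_pdivrMr// ler_wpM2l ?ler_nat// ltW.
Qed.

Lemma C1_strict n m (f : 'rV[R]_n -> 'rV[R]_m) (A : set 'rV[R]_n) x0 (e : R) :
  open A -> A x0 -> Ck_on 1 A f -> 0 < e ->
  \forall r \near 0^'+, forall x y, `|x - x0| < r -> `|y - x0| < r ->
    `|f y - f x - 'd f x0 (y - x)| <= e * `|y - x|.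
Proof.
move=> oA Ax0 Cf e0; have [df _] := Cf.
apply: filterS (C1_diff_near oA Ax0 Cf e0) => r Hr x y xr yr.
apply: (@mvt_ball _ _ _ x0 r) => //.
- by move=> z /Hr[/df].
- by rewrite mulr_ge0// ltW.
by move=> z /Hr[_ Hz] _.
Qed.

Lemma C1_lipschitz n m (f : 'rV[R]_n -> 'rV[R]_m) (A : set 'rV[R]_n) x0 :
  open A -> A x0 -> Ck_on 1 A f ->
  exists2 L, 0 <= L & \forall r \near 0^'+,
    forall x y, `|x - x0| < r -> `|y - x0| < r ->
      `|f y - f x| <= L * `|y - x| /\ forall v, `|'d f x v| <= L * `|v|.
Proof.
move=> oA Ax0 Cf; have [df _] := Cf.
(* A bound of ['d f x0], plus the error 1 allowed by the two estimates taken with [e = 1]. *)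
exists (1 + \sum_(i < n) `|'d f x0 (delta_mx 0 i)|).
  by rewrite addr_ge0// sumr_ge0.
apply: filterS2 (C1_diff_near oA Ax0 Cf ltr01) (C1_strict oA Ax0 Cf ltr01).
move=> r Hd Hr x y xr yr; split=> [|v].
  rewrite mulrDl -[f y - f x](subrK ('d f x0 (y - x))).
  by apply: le_trans (ler_normD _ _) _; rewrite lerD ?Hr ?linear_bound.
have [_ /(_ v) Hx] := Hd x xr.
have := ler_normD ('d f x v - 'd f x0 v) ('d f x0 v); rewrite subrK => H.
by apply: le_trans H _; rewrite mulrDl; apply: lerD Hx (linear_bound _ _).
Qed.

Lemma C2_taylor n m (f : 'rV[R]_n -> 'rV[R]_m) (A : set 'rV[R]_n) x0 :
  open A -> A x0 -> Ck_on 2 A f ->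
  exists2 C, 0 <= C & \forall r \near 0^'+,
    forall x y, `|x - x0| < r -> `|y - x0| < r ->
      `|f y - f x - 'd f x (y - x)| <= C * `|y - x| ^+ 2.
Proof.
move=> oA Ax0 [df Cf].
have /choice[L HL] i : exists L, 0 <= L /\ \forall r \near 0^'+,
    forall x y, `|x - x0| < r -> `|y - x0| < r ->
    `|'D_(delta_mx 0 i) f y - 'D_(delta_mx 0 i) f x| <= L * `|y - x|.
  have [L L0 HL] := C1_lipschitz oA Ax0 (Cf i); exists L; split => //.
  by apply: filterS HL => r Hr x y xr yr; case: (Hr x y xr yr).
exists (\sum_i L i); first by apply: sumr_ge0 => i _; case: (HL i).
have nA : nbhs x0 A by apply: open_nbhs_nbhs.
have nL : \forall r \near 0^'+, forall i x y, `|x - x0| < r -> `|y - x0| < r ->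
    `|'D_(delta_mx 0 i) f y - 'D_(delta_mx 0 i) f x| <= L i * `|y - x|.
  by apply: filter_forall => i; case: (HL i).
apply: filterS2 (near_ball nA) nL => r rA Hr x y xr yr.
apply: (@mvt_ball _ _ _ x0 r) => //.
- by move=> z /rA/df.
- by rewrite mulr_ge0 ?sqr_ge0// sumr_ge0// => i _; case: (HL i).
(* The bound [|z - x| <= |y - x|] supplied by [mvt_ball] turns the Lipschitz estimate of the partial
   derivatives into the second factor [|y - x|]. *)
move=> z zr zx.
have -> : 'd f z (y - x) - 'd f x (y - x) = ('d f z \- 'd f x) (y - x) by [].
apply: le_trans (linear_bound _ _) _; rewrite expr2 mulrA ler_wpM2r//.
rewrite mulr_suml; apply: ler_sum => i _; have := Hr i x z xr zr.
rewrite (deriveE _ (df _ (rA _ zr))) (deriveE _ (df _ (rA _ xr))) => Hi.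
by apply: le_trans Hi _; apply: ler_wpM2l => //; case: (HL i).
Qed.

End Calculus.

(** Identities between charts hold only on their domains, so differentials have to be compared
    through germs, by uniqueness of the first order expansion. *)
Lemma near_eq_diff (R : realType) (V W : normedModType R) (f h : V -> W) x :
  (\near x, f x = h x) -> differentiable f x ->
  differentiable h x /\ forall v, 'd h x v = 'd f x v.
Proof.
move=> fh df.
have [cf /eqaddoP Hf] := (diff_locallyP x f).1 df.
have fx : f x = h x by exact: nbhs_singleton fh.
have E : h \o shift x = cst (h x) + 'd f x +o_ 0 id.
  apply/eqaddoP => e e0; have := Hf e e0.
  have : \forall y \near 0, f (shift x y) = h (shift x y).
    by move: fh; rewrite (near_shift 0)/= => fh; near=> y => /=;
      rewrite -[x in y + x]subr0; near: y.
  by apply: filterS2 => y /= E; rewrite !fctE /= -fx -E.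
have D : 'd h x = 'd f x :> (V -> W) by exact: diff_unique.
split; last by rewrite D.
by apply/diff_locallyP; rewrite D.
Unshelve. all: by end_near. Qed.

Lemma near_diff_comp (R : realType) (U V W : normedModType R) (f : U -> V)
    (g : V -> W) (h : U -> W) x y v :
  (\near x, g (f x) = h x) -> y = f x -> differentiable f x ->
  differentiable g y -> 'd h x v = 'd g y ('d f x v).
Proof.
move=> E -> df dg; have dgf := differentiable_comp df dg.
have [_ H] := @near_eq_diff _ _ _ _ h _ E dgf.
exact: etrans (H v) (congr1 (fun l : U -> W => l v) (diff_comp df dg)).
Qed.

Lemma near_norm_lt (R : realType) (V : normedModType R) (x x0 : V) (r : R) :
  `|x - x0| < r -> \forall y \near x, `|y - x0| < r.
Proof.
rewrite -subr_gt0 => xr; apply/nbhs_normP; exists (r - `|x - x0|) => //= y /= yr.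
have := ler_normD (y - x) (x - x0); rewrite addrA subrK (distrC y x); lra.
Qed.

Lemma compact_normed_ball (R : realType) n (x0 : 'rV[R]_n) (r : R) :
  compact [set x | `|x - x0| <= r].
Proof.
apply: bounded_closed_compact.
  exists (r + `|x0|); split; first exact: num_real.
  move=> K rK x /= xr; apply/ltW/(le_lt_trans _ rK).
  by rewrite -{1}(subrK x0 x); apply: le_trans (ler_normD _ _) _; rewrite lerD2r.
apply: (@preimage_closed _ R^o (fun x : 'rV[R]_n => (`|x - x0| : R^o))
  [set s | s <= r]); last exact: closed_le.
move=> x _; apply: continuous_comp; last exact: norm_continuous.
exact: (@cvgB _ _ _ (nbhs x) _ id (cst x0) _ _ cvg_id (cvg_cst _)).
Qed.

(** * Vector fields and flows in charts *)

Section Charts.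
Context {R : realType} {n : nat} {M : manifold R n}.
Implicit Types (a b : chart R M n) (p : M) (x v : 'rV[R]_n)
  (V Y Z : M -> 'rV[R]_n).

Definition image a := coord a @` dom a.

Lemma icoordK a x : atlas a -> image a x ->
  dom a (icoord a x) /\ coord a (icoord a x) = x.
Proof. by move=> /atlas_charts[_ _ H _ _] [p ap <-]; rewrite H. Qed.

Lemma coordK a p : atlas a -> dom a p -> icoord a (coord a p) = p.
Proof. by move=> /atlas_charts[_ _ H _ _]; exact: H. Qed.

Lemma nbhs_dom a p : atlas a -> dom a p -> nbhs p (dom a).
Proof. by move=> /atlas_charts[? _ _ _ _] ?; apply: open_nbhs_nbhs. Qed.

Lemma nbhs_image a p : atlas a -> dom a p -> nbhs (coord a p) (image a).
Proof.
by move=> /atlas_charts[_ ? _ _ _] ?; apply: open_nbhs_nbhs; split => //;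
  exists p.
Qed.

Lemma coord_cvg a p : atlas a -> dom a p -> {for p, continuous (coord a)}.
Proof. by move=> /atlas_charts[_ _ _ H _]; exact: H. Qed.

Lemma icoord_cvg a x : atlas a -> image a x -> {for x, continuous (icoord a)}.
Proof. by move=> /atlas_charts[_ _ _ _ H]; exact: H. Qed.

Lemma near_icoord a p (P : set M) : atlas a -> dom a p -> nbhs p P ->
  \forall x \near coord a p, P (icoord a x).
Proof.
move=> aa ap pP; have := icoord_cvg aa (imageP _ ap).
by rewrite /prop_for/continuous_at coordK//; apply.
Qed.

Lemma near_coord a p (P : set 'rV[R]_n) : atlas a -> dom a p ->
  nbhs (coord a p) P -> \forall q \near p, dom a q /\ P (coord a q).
Proof.
move=> aa ap pP; apply: filterI; first exact: nbhs_dom.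
exact: (coord_cvg aa ap).
Qed.

Lemma transition_diff a b p : atlas a -> atlas b -> dom a p -> dom b p ->
  differentiable (coord b \o icoord a) (coord a p).
Proof.
move=> aa ab ap bp; have [D _] := atlas_smooth 1 aa ab.
by apply: D; exists p.
Qed.

Lemma push_change a b p v : atlas a -> atlas b -> dom a p -> dom b p ->
  push b p v = 'd (coord b \o icoord a) (coord a p) (push a p v).
Proof.
move=> aa ab ap bp; rewrite /push.
set c := chart_at p; have ac : atlas c := chart_at_atlas p.
have cp : dom c p := chart_at_dom p.
have E : \forall x \near coord c p,
    (coord b \o icoord a) ((coord a \o icoord c) x) = (coord b \o icoord c) x.
  apply: filterS (near_icoord ac cp (nbhs_dom aa ap)) => x ax /=.
  by rewrite coordK.
exact: near_diff_comp E (esym (congr1 (coord a) (coordK ac cp)))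
  (transition_diff ac aa cp ap) (transition_diff aa ab ap bp).
Qed.

Lemma push_chart_at p v : push (chart_at p) p v = v.
Proof.
have ac : atlas (chart_at p) := chart_at_atlas p.
have cp : dom (chart_at p) p := chart_at_dom p.
have E : \forall x \near coord (chart_at p) p,
    id x = (coord (chart_at p) \o icoord (chart_at p)) x.
  apply: filterS (nbhs_image ac cp) => x ax /=.
  by have [_ ->] := icoordK ac ax.
have [D ID] := is_diff_id (coord (chart_at p) p).
have [_ H] := near_eq_diff E D.
by rewrite /push H ID.
Qed.

Lemma push_lin a p c v w : push a p (c *: v + w) = c *: push a p v + push a p w.
Proof. by rewrite /push linearP. Qed.

Lemma field_inE a V p : atlas a -> dom a p ->
  field_in a V (coord a p) = push a p (V p).
Proof. by move=> aa ap; rewrite /field_in coordK. Qed.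

Lemma field_in_lin a V Y (c : R) x :
  field_in a (fun p => V p - c *: Y p) x = field_in a V x - c *: field_in a Y x.
Proof.
by rewrite /field_in addrC -scaleNr push_lin scaleNr addrC.
Qed.

Lemma field_in_change a b V p : atlas a -> atlas b -> dom a p -> dom b p ->
  field_in b V (coord b p) =
  'd (coord b \o icoord a) (coord a p) (field_in a V (coord a p)).
Proof. by move=> aa ab ap bp; rewrite !field_inE// (push_change _ aa ab). Qed.

(** Tangency at a single instant, so that a curve can be pushed forward by a flow one time at a
    time. Continuity is required separately: [coord a] is a total function, and a derivative of
    [coord a \o c] does not keep [c] in the domain of [a]. *)
Definition moves V (c : R -> M) (t : R) : Prop :=
  {for t, continuous c} /\ forall a, atlas a -> dom a (c t) ->
    is_derive (t : R) (1 : R) (coord a \o c) (field_in a V (coord a (c t))).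

Lemma moves_chart V c t a : {for t, continuous c} -> atlas a -> dom a (c t) ->
  is_derive (t : R) (1 : R) (coord a \o c) (field_in a V (coord a (c t))) ->
  moves V c t.
Proof.
move=> cc aa ac D; split => // b ab bc.
have := is_derive_comp D (transition_diff aa ab ac bc).
rewrite -field_in_change//; apply: near_eq_is_derive.
have : \forall s \near t, dom a (c s) by exact: (cc _ (nbhs_dom aa ac)).
by apply: filterS => s /= sa; rewrite coordK.
Qed.

Definition flow_line V (c : R -> M) : Prop := forall t, moves V c t.

Lemma flow_line_integral V c : integral_curve V setT setT c -> flow_line V c.
Proof.
move=> [cc _ D] t.
have {}cc : {for t, continuous c} by apply: ((continuous_subspace_setT c).2 cc).
apply: (@moves_chart V c t (chart_at (c t))) => //.
- exact: chart_at_atlas.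
- exact: chart_at_dom.
rewrite field_inE ?push_chart_at; [|exact: chart_at_atlas|exact: chart_at_dom].
by apply: D; rewrite interiorT.
Qed.

Lemma Ck_onW m k (A : set 'rV[R]_n) (f : 'rV[R]_n -> 'rV[R]_m) :
  Ck_on k.+1 A f -> Ck_on k A f.
Proof.
elim: k f => [f [df _] x Ax|k IH f [df Cf]].
  exact/differentiable_continuous/df.
by split=> // i; apply/IH/Cf.
Qed.

(** A curve might leave the chart while its coordinates stay bounded. Up to the first bad time [T]
    it lies in the image of a closed ball of radius less than [r]; this image is compact, hence
    closed because the manifold is Hausdorff, and so contains [c T] as well. The velocity [dc] need
    not come from a field, which allows time-reversed curves. *)
Lemma speed_trap (c : R -> M) (dc : R -> 'rV[R]_n) a x0 (r K e t0 : R) :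
  continuous c -> atlas a -> 0 <= K -> (forall x, `|x - x0| < r -> image a x) ->
  (forall t, dom a (c t) -> `|coord a (c t) - x0| < r ->
    is_derive (t : R) (1 : R) (coord a \o c) (dc t) /\ `|dc t| <= K) ->
  dom a (c t0) -> `|coord a (c t0) - x0| + K * e < r ->
  forall t, t0 <= t <= t0 + e -> dom a (c t) /\ `|coord a (c t) - x0| < r.
Proof.
move=> cc aa K0 im D c0 c0r t /andP[t0t te]; apply: contrapT => Nt.
pose N t := dom a (c t) /\ `|coord a (c t) - x0| < r.
have e0 : 0 <= e by lra.
have Ke0 : 0 <= K * e by rewrite mulr_ge0.
have N0 : N t0 by split => //; lra.
have oN s : N s -> \forall s' \near s, N s'.
  move=> [as_ rs]; apply: (cc s [set p | dom a p /\ `|coord a p - x0| < r]).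
  exact: (near_coord aa as_ (near_norm_lt rs)).
pose E := [set s | t0 <= s /\ ~ N s].
have Et : E t by [].
have lbE : lbound E t0 by move=> s [].
have infE : has_inf E by split; [exists t|exists t0].
pose T := inf E.
have t0T : t0 <= T by apply: lb_le_inf => //; exists t.
have Tt : T <= t by apply: ge_inf => //; exists t0.
have beforeT s : t0 <= s -> s < T -> N s.
  move=> s0 sT; apply: contrapT => Ns.
  have : T <= s by apply: ge_inf; [exists t0|].
  by rewrite leNgt sT.
have NT : ~ N T.
  move=> /oN/nbhs_normP[d /= d0 Hd].
  have [s [s0 Ns] sT] := inf_adherent d0 infE.
  have Ts : T <= s by apply: ge_inf => //; exists t0.
  apply: Ns; apply: Hd; rewrite /= distrC ger0_norm ?subr_ge0//.
  by rewrite ltrBlDl.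
have t0ltT : t0 < T.
  by rewrite lt_neqAle t0T andbT; apply/eqP => E0; apply: NT; rewrite -E0.
pose r' := `|coord a (c t0) - x0| + K * e.
pose D' := icoord a @` [set x | `|x - x0| <= r'].
have cD : closed D'.
  apply: compact_closed; first exact: manifold_hausdorff.
  apply: continuous_compact.
    apply: continuous_in_subspaceT => x; rewrite inE /= => xr.
    by apply: icoord_cvg => //; apply: im; apply: le_lt_trans c0r.
  exact: compact_normed_ball.
have beforeD s : t0 <= s -> s < T -> D' (c s).
  move=> s0 sT; have [as_ _] := beforeT s s0 sT.
  exists (coord a (c s)); last by rewrite coordK.
  rewrite /= -(subrK (coord a (c t0)) (coord a (c s))) -addrA.
  apply: le_trans (ler_normD _ _) _; rewrite [leLHS]addrC lerD2l.
  have Dt u : t0 <= u <= s -> N u.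
    by move=> /andP[u0 us]; apply: beforeT => //; apply: le_lt_trans sT.
  apply: le_trans (mvt_rV (c := coord a \o c) (dc := dc) s0 K0 _ _) _.
  - by move=> u /Dt[au ur]; case: (D u au ur).
  - by move=> u /Dt[au ur]; case: (D u au ur).
  by rewrite ler_wpM2l//; lra.
have [x xr' cx] : D' (c T).
  apply: cD => /= O /(cc T) TO.
  have /nbhs_normP[d /= d0 Hd] := TO.
  pose s := Num.max t0 (T - d / 2).
  have sT : s < T by rewrite gt_max t0ltT /=; lra.
  have s0 : t0 <= s by rewrite le_max lexx.
  exists (c s); split; first exact: beforeD.
  apply: Hd => /=; rewrite ger0_norm ?subr_ge0 ?(ltW sT)//.
  have : T - d / 2 <= s by rewrite le_max lexx orbT.
  lra.
have xr : `|x - x0| < r by apply: le_lt_trans c0r.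
have [xa xK] := icoordK aa (im _ xr).
by apply: NT; rewrite /N -cx xK.
Qed.

End Charts.

(** * Flow boxes, uniqueness and continuity of flows *)

Section FlowBox.
Context {R : realType} {n : nat} {M : manifold R n}.
Implicit Types (a b : chart R M n) (p q : M) (x v : 'rV[R]_n)
  (V Y Z : M -> 'rV[R]_n).

(* On the coordinate ball of radius [r], [L] and [K] are first and second order
   bounds for [Y]; [e] is short both for the Gronwall estimate and for
   trajectories starting in the ball of radius [r / 2] to stay in it. *)
Record flow_box Y q (P : set 'rV[R]_n) (r e L K : R) : Prop := FlowBox {
  fb_r : 0 < r; fb_e : 0 < e; fb_L : 0 <= L; fb_K : 0 <= K;
  fb_eL : e * L <= 2^-1;
  fb_image : forall x, `|x - coord (chart_at q) q| < r ->
    image (chart_at q) x /\ P x;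
  fb_lipschitz : forall x y, `|x - coord (chart_at q) q| < r ->
    `|y - coord (chart_at q) q| < r ->
    `|field_in (chart_at q) Y y - field_in (chart_at q) Y x| <= L * `|y - x|;
  fb_diff : forall x v, `|x - coord (chart_at q) q| < r ->
    `|'d (field_in (chart_at q) Y) x v| <= L * `|v|;
  fb_taylor : forall x y, `|x - coord (chart_at q) q| < r ->
    `|y - coord (chart_at q) q| < r ->
    `|field_in (chart_at q) Y y - field_in (chart_at q) Y x
      - 'd (field_in (chart_at q) Y) x (y - x)| <= K * `|y - x| ^+ 2;
  fb_trap : forall c t0, flow_line Y c -> dom (chart_at q) (c t0) ->
    `|coord (chart_at q) (c t0) - coord (chart_at q) q| < r / 2 ->
    forall t, `|t - t0| <= e -> dom (chart_at q) (c t) /\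
      `|coord (chart_at q) (c t) - coord (chart_at q) q| < r }.

Lemma flow_line_continuous Y c : flow_line Y c -> continuous c.
Proof. by move=> fc t; case: (fc t). Qed.

Lemma is_derive_rev (W : normedModType R) (c : R -> W) (s t : R) w :
  is_derive (s - t : R) (1 : R) c w ->
  is_derive (t : R) (1 : R) (fun u => c (s - u)) (- w).
Proof.
move=> [/derivable1_diffP D <-].
have Dl : is_derive (t : R) (1 : R) (fun u : R => s - u) (-1 : R).
  have := @is_derive_line R R^o t s (-1).
  by under eq_fun do rewrite scalerN [_ *: 1]mulr1.
by rewrite deriveE// -linearN; exact: (is_derive_comp Dl D).
Qed.

Lemma flow_box_exists Y q (P : set 'rV[R]_n) : Ck_field 3 Y ->
  nbhs (coord (chart_at q) q) P -> exists r e L K, flow_box Y q P r e L K.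
Proof.
move=> CY nP; set a := chart_at q; set x0 := coord a q.
have aa : atlas a := chart_at_atlas q.
have aq : dom a q := chart_at_dom q.
set f := field_in a Y.
have Cf : Ck_on 3 (image a) f := CY a aa.
have oI : open (image a) by case: (atlas_charts aa).
have x0I : image a x0 by exists q.
have Cf2 := Ck_onW Cf; have Cf1 := Ck_onW Cf2.
have cf : {for x0, continuous f}.
  by apply: differentiable_continuous; case: Cf1 => + _; apply.
have [L L0 HL] := C1_lipschitz oI x0I Cf1.
have [C C0 HC] := C2_taylor oI x0I Cf2.
have nP' : \forall x \near x0, (image a x /\ P x) /\ `|f x - f x0| < 1.
  apply: filterI; first by apply: filterI => //; apply: nbhs_image.
  have /cvgrPdist_lt/(_ 1 ltr01) := cf.
  by apply: filterS => x; rewrite distrC.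
have /filter_ex[r [[[r0 HL'] HC'] HP']] : \forall r \near 0^'+, ((0 < r /\
    (forall x y, `|x - x0| < r -> `|y - x0| < r ->
      `|f y - f x| <= L * `|y - x| /\ forall v, `|'d f x v| <= L * `|v|)) /\
    (forall x y, `|x - x0| < r -> `|y - x0| < r ->
      `|f y - f x - 'd f x (y - x)| <= C * `|y - x| ^+ 2)) /\
    (forall x, `|x - x0| < r -> (image a x /\ P x) /\ `|f x - f x0| < 1).
  apply: filterI; last exact: near_ball.
  apply: filterI; last exact: HC.
  by apply: filterI; [exact: nbhs_right_gt|exact: HL].
pose K := `|f x0| + 1.
have K0 : 0 < K by rewrite ltr_wpDl.
have fK x : `|x - x0| < r -> `|f x| <= K.
  move=> /HP'[_ fx]; rewrite -(subrK (f x0) (f x)) addrC.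
  by apply: le_trans (ler_normD _ _) _; rewrite lerD2l ltW.
(* The first term serves the Gronwall estimate, with [L + 1] since [L] may vanish; the second limits
   the displacement to [r / 4], so that a start within [r / 2] stays within [r]. *)
pose e := Num.min (2^-1 / (L + 1)) (r / 4 / K).
have L1 : 0 < L + 1 by rewrite ltr_wpDl.
have e0 : 0 < e by rewrite lt_min !divr_gt0.
have eL : e * L <= 2^-1.
  apply: le_trans (_ : e * (L + 1) <= _).
    by rewrite ler_wpM2l ?(ltW e0)// lerDl.
  by rewrite -ler_pdivlMr// ge_min lexx.
have Ke : K * e <= r / 4 by rewrite mulrC -ler_pdivlMr// ge_min lexx orbT.
exists r, e, L, C; split => //.
- by move=> x /HP'[].
- by move=> x y xr yr; case: (HL' x y xr yr).
- by move=> x v xr; case: (HL' x x xr xr).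
move=> c t0 fc ac0 cr0 t tt0.
have cc := flow_line_continuous fc.
have im x : `|x - x0| < r -> image a x by move=> /HP'[[]].
have small : `|coord a (c t0) - x0| + K * e < r by rewrite -/a -/x0 in cr0; lra.
have D s : dom a (c s) -> `|coord a (c s) - x0| < r ->
    is_derive (s : R) (1 : R) (coord a \o c) (f (coord a (c s))) /\
    `|f (coord a (c s))| <= K.
  by move=> as_ rs; split; [case: (fc s) => _; apply|exact: fK].
have [t0t|tt0'] := leP t0 t.
  apply: (speed_trap cc aa (ltW K0) im D ac0 small).
  by rewrite t0t/=; rewrite ger0_norm ?subr_ge0// in tt0; lra.
(* Earlier times are reached by reflecting the curve about [t0], which changes the sign of its
   velocity but not the bound. *)
pose c' s := c (t0 + t0 - s).
have cc' : continuous c'.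
  move=> s; apply: continuous_comp; last exact: cc.
  exact: (@cvgB _ _ _ (nbhs s) _ (cst (t0 + t0)) id _ _ (cvg_cst _) cvg_id).
have D' s : dom a (c' s) -> `|coord a (c' s) - x0| < r ->
    is_derive (s : R) (1 : R) (coord a \o c') (- f (coord a (c' s))) /\
    `|- f (coord a (c' s))| <= K.
  move=> as_ rs; have [H1 H2] := D _ as_ rs; split; last by rewrite normrN.
  exact: (is_derive_rev H1).
have E : c' t0 = c t0 by rewrite /c' addrK.
have := @speed_trap _ _ _ c' _ a x0 r K e t0 cc' aa (ltW K0) im D'.
rewrite E => /(_ ac0 small (t0 + t0 - t)).
have -> : c' (t0 + t0 - t) = c t by rewrite /c' subKr.
apply.
by rewrite ler0_norm ?subr_le0 ?(ltW tt0')// in tt0; lra.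
Qed.

End FlowBox.

(** Transfer in both directions between nearby times makes the set of good times open and closed in
    the line. *)
Lemma real_propagate (R : realType) (P : R -> Prop) (t0 : R) : P t0 ->
  (forall s, exists2 e, 0 < e & forall s1 s2, `|s1 - s| < e -> `|s2 - s| < e ->
    P s1 -> P s2) ->
  forall s, P s.
Proof.
move=> P0 H; suff -> : P = setT :> set R by [].
have /connected_intervalP : is_interval [set: R] by [].
apply; first by exists t0.
  exists P; last by rewrite setTI.
  move=> s Ps; have [e e0 He] := H s.
  exists e => //= u; rewrite /ball_/= distrC => us.
  by apply: (He s u) => //; rewrite subrr normr0.
exists P; last by rewrite setTI.
have oC : open (~` P : set R).
  move=> s nPs; have [e e0 He] := H s.
  exists e => //= u; rewrite /ball_/= distrC => us Pu; apply: nPs.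
  by apply: (He u s) => //; rewrite subrr normr0.
by have := open_closedC oC; rewrite setCK.
Qed.

Section FlowTheory.
Context {R : realType} {n : nat} {M : manifold R n}.
Implicit Types (a b : chart R M n) (p q : M) (x v : 'rV[R]_n)
  (V X Y Z : M -> 'rV[R]_n).

Definition half_box q (r : R) : set M := [set p | dom (chart_at q) p /\
  `|coord (chart_at q) p - coord (chart_at q) q| < r / 2].

Lemma nbhs_half_box q r : 0 < r -> nbhs q (half_box q r).
Proof.
move=> r0.
apply: (@near_coord _ _ _ (chart_at q) q
  [set x | `|x - coord (chart_at q) q| < r / 2] (chart_at_atlas q) (chart_at_dom q)).
have H : `|coord (chart_at q) q - coord (chart_at q) q| < r / 2.
  by rewrite subrr normr0 divr_gt0.
exact: (near_norm_lt H).
Qed.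

Lemma flow_line_derive Y c t a : flow_line Y c -> atlas a -> dom a (c t) ->
  is_derive (t : R) (1 : R) (coord a \o c) (field_in a Y (coord a (c t))).
Proof. by move=> fc aa; case: (fc t) => _; apply. Qed.

Lemma flow_box_pair Y q P r e L K c d (t0 t : R) : flow_box Y q P r e L K ->
  flow_line Y c -> flow_line Y d -> half_box q r (c t0) -> half_box q r (d t0) ->
  `|t - t0| <= e ->
  `|coord (chart_at q) (c t) - coord (chart_at q) (d t)| <=
  2 * `|coord (chart_at q) (c t0) - coord (chart_at q) (d t0)|.
Proof.
move=> B fc fd [c1 c2] [d1 d2] te; set a := chart_at q.
have aa : atlas a := chart_at_atlas q.
have := @short_gronwall _ _ (fun s => coord a (c s) - coord a (d s))
  (fun s => field_in a Y (coord a (c s)) - field_in a Y (coord a (d s)))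
  t0 e L 0 t te (fb_L B) (lexx _) (fb_eL B).
rewrite mulr0 addr0; apply.
  move=> s /[dup] /(fb_trap B fc c1 c2)[ac _] /(fb_trap B fd d1 d2)[ad _].
  exact: (is_deriveB (flow_line_derive fc aa ac) (flow_line_derive fd aa ad)).
move=> s /[dup] /(fb_trap B fc c1 c2)[_ ac] /(fb_trap B fd d1 d2)[_ ad].
by rewrite addr0; exact: (fb_lipschitz B).
Qed.

Lemma flow_line_unique Y c d t0 : Ck_field 3 Y -> flow_line Y c ->
  flow_line Y d -> c t0 = d t0 -> c = d.
Proof.
move=> CY fc fd E; apply/funext.
apply: (@real_propagate _ (fun t => c t = d t) t0) => // s.
have [cds|/eqP cds] := pselect (c s = d s).
  have [r [e [L [K B]]]] := flow_box_exists CY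
    (@filterT _ (nbhs (coord (chart_at (c s)) (c s))) _).
  have e0 := fb_e B; have r0 := fb_r B.
  have : \forall u \near s, half_box (c s) r (c u) /\ half_box (c s) r (d u).
    apply: filterI; [apply: (flow_line_continuous fc)|apply: (flow_line_continuous fd)].
      exact: nbhs_half_box.
    by rewrite -cds; exact: nbhs_half_box.
  move=> /nbhs_normP[e' /= e'0 He'].
  exists (Num.min e' (e / 2)); first by rewrite lt_min e'0 divr_gt0.
  move=> s1 s2; rewrite !lt_min => /andP[s1e s1e2] /andP[s2e s2e2] cd.
  have [|hc hd] := He' s1; first by rewrite /= distrC.
  have s12 : `|s2 - s1| <= e.
    by have := ler_distD s s2 s1; rewrite (distrC s s1); lra.
  have := flow_box_pair B fc fd hc hd s12.
  have s22 : `|s1 - s1| <= e by rewrite subrr normr0 ltW.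
  have [a2 _] := fb_trap B fc hc.1 hc.2 s12.
  have [b2 _] := fb_trap B fd hd.1 hd.2 s12.
  rewrite cd subrr normr0 mulr0 normr_le0 subr_eq0 => /eqP Ec.
  have aa := chart_at_atlas (c s).
  by rewrite -(coordK aa a2) -(coordK aa b2) Ec.
(* Where the two curves differ they have disjoint neighbourhoods, and nearby the premise of the
   transfer is false. *)
have := @manifold_hausdorff _ _ M; rewrite open_hausdorff => /(_ _ _ cds).
move=> [[A B] [/= Ac Bd] [oA oB AB]].
rewrite !inE in Ac Bd.
have : \forall u \near s, A (c u) /\ B (d u).
  by apply: filterI; [apply: (flow_line_continuous fc)|apply: (flow_line_continuous fd)];
     apply: open_nbhs_nbhs.
move=> /nbhs_normP[e' /= e'0 He']; exists e' => // s1 s2 s1e _ cd.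
have [|As Bs] := He' s1; first by rewrite /= distrC.
by move/eqP: AB => /seteqP[/(_ (c s1)) AB _]; case: AB; split; rewrite // cd.
Qed.

Lemma moves_shift V c (s t : R) : moves V c (t + s) ->
  moves V (fun u => c (u + s)) t.
Proof.
move=> [cc D]; have cs : {for t, continuous (fun u : R => u + s)}.
  exact: (@cvgD _ _ _ (nbhs t) _ id (cst s) _ _ cvg_id (cvg_cst _)).
split; first exact: (continuous_comp cs).
move=> a aa ac; have [/derivable1_diffP Da <-] := D a aa ac.
have Dl : is_derive (t : R) (1 : R) (fun u : R => u + s) (1 : R).
  have := @is_derive_line R R^o t s 1.
  by under eq_fun do rewrite [_ *: 1]mulr1 addrC.
by rewrite deriveE//; exact: (is_derive_comp Dl Da).
Qed.

Section OneFlow.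
Variables (Y : M -> 'rV[R]_n) (phi : R -> M -> M).
Hypotheses (CY : Ck_field 3 Y) (Fphi : is_flow Y phi).

Lemma flow0 p : phi 0 p = p.
Proof. by case: (Fphi p). Qed.

Lemma flow_flow_line p : flow_line Y (phi ^~ p).
Proof. by case: (Fphi p) => _; exact: flow_line_integral. Qed.

Lemma flowD (s t : R) p : phi (t + s) p = phi t (phi s p).
Proof.
have fc : flow_line Y (fun u => phi (u + s) p).
  by move=> u; apply: (@moves_shift _ (phi ^~ p)); exact: flow_flow_line.
have := @flow_line_unique Y _ _ 0 CY fc (flow_flow_line (phi s p)).
by rewrite add0r flow0 => /(_ erefl) /(congr1 (fun h => h t)).
Qed.

(** The flow box is taken inside the target neighbourhood, so that trapping alone gives the
    limit. *)
Lemma flow_cvg0 q : (phi z.1 z.2) @[z --> ((0 : R), q)] --> q.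
Proof.
move=> P nP; set a := chart_at q.
have nP' := near_icoord (chart_at_atlas q) (chart_at_dom q) nP.
have [r [e [L [K B]]]] := flow_box_exists CY nP'.
exists ([set t : R | `|t| < e], half_box q r).
  split => /=; last exact/nbhs_half_box/(fb_r B).
  apply/nbhs_normP; exists e => /=; first exact: fb_e B.
  by move=> t /=; rewrite sub0r normrN.
move=> [t p] /= [te [p1 p2]].
have := fb_trap B (flow_flow_line p) (t0 := 0); rewrite flow0 => /(_ p1 p2 t).
rewrite subr0 => /(_ (ltW te))[ap pr].
have [_] := fb_image B pr; rewrite coordK//; exact: chart_at_atlas.
Qed.

Lemma flow_time_continuous t p : {for p, continuous (phi t)}.
Proof.
move: t; apply: (@real_propagate _ (fun t => {for p, continuous (phi t)}) 0).
  suff -> : phi 0 = id by exact: cvg_id.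
  by apply/funext => q; exact: flow0.
move=> s; set q := phi s p; have aa := chart_at_atlas q.
have [r [e [L [K B]]]] := flow_box_exists CY
  (@filterT _ (nbhs (coord (chart_at q) q)) _).
have e0 := fb_e B; have r0 := fb_r B.
(* For short times, distances between trajectories starting in the half box at most double. *)
have hc (u : R) p1 : half_box q r p1 -> `|u| <= e -> {for p1, continuous (phi u)}.
  move=> hp1 ue.
  have trap p2 : half_box q r p2 -> dom (chart_at q) (phi u p2).
    move=> [h1 h2]; have := fb_trap B (flow_flow_line p2) (t0 := 0).
    by rewrite flow0 => /(_ h1 h2 u); rewrite subr0 => /(_ ue)[].
  move=> P nP.
  have /nbhs_normP[d /= d0 Hd] := near_icoord aa (trap _ hp1) nP.
  have : \forall p2 \near p1, (half_box q r p2) /\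
      `|coord (chart_at q) p2 - coord (chart_at q) p1| < d / 2.
    apply: filterS2 (near_coord aa hp1.1 (near_norm_lt hp1.2))
      (near_coord aa hp1.1 (near_norm_lt (x0 := coord (chart_at q) p1) (r := d / 2) _)).
      by move=> p2 [? ?] [].
    by rewrite subrr normr0 divr_gt0.
  apply: filterS => p2 [hp2 dp2] /=.
  rewrite -(coordK aa (trap _ hp2)); apply: Hd => /=.
  have := flow_box_pair (t := u) B (flow_flow_line p1) (flow_flow_line p2) (t0 := 0).
  rewrite !flow0 subr0 => /(_ hp1 hp2 ue).
  by rewrite [X in _ <= 2 * X]distrC; lra.
have : \forall u \near s, half_box q r (phi u p).
  by apply: (flow_line_continuous (flow_flow_line p)); exact: nbhs_half_box.
move=> /nbhs_normP[e' /= e'0 He'].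
exists (Num.min e' (e / 2)); first by rewrite lt_min e'0 divr_gt0.
move=> s1 s2; rewrite !lt_min => /andP[s1e s1e2] /andP[s2e s2e2] cs1.
have s12 : `|s2 - s1| <= e.
  by have := ler_distD s s2 s1; rewrite (distrC s s1); lra.
have -> : phi s2 = phi (s2 - s1) \o phi s1.
  by apply/funext => z /=; rewrite -flowD subrK.
apply: continuous_comp cs1 _; apply: hc => //.
by apply: He'; rewrite /= distrC.
Qed.

Lemma flow_continuous : continuous (fun z : R * M => phi z.1 z.2).
Proof.
move=> [t p] /=.
have H1 : (z.1 - t) @[z --> (t, p)] --> (0 : R).
  rewrite -(subrr t); apply: (@cvgB _ R^o); [exact: cvg_fst|exact: cvg_cst].
have H2 : phi t z.2 @[z --> (t, p)] --> phi t p.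
  apply: (@cvg_comp _ _ _ (fun z : R * M => z.2) (phi t) (nbhs (t, p)) (nbhs p)).
    exact: cvg_snd.
  exact: flow_time_continuous.
have H : (z.1 - t, phi t z.2) @[z --> (t, p)] --> ((0 : R), phi t p).
  exact: (cvg_pair H1 H2).
(* Splitting off the fixed time [t] leaves a joint limit at time 0, at the point [phi t p]. *)
have -> : (fun z : R * M => phi z.1 z.2) = (fun z => phi (z.1 - t) (phi t z.2)).
  by apply/funext => z /=; rewrite -flowD subrK.
rewrite /continuous_at /= subrr flow0.
apply: (@cvg_comp _ _ _ (fun z : R * M => (z.1 - t, phi t z.2))
  (fun z : R * M => phi z.1 z.2) _ _ _ H).
exact: flow_cvg0.
Qed.

End OneFlow.
End FlowTheory.

Lemma linear_subZ (R : realType) (V W : normedModType R) (A : {linear V -> W})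
    (c : R) u v : A (u - c *: v) = A u - c *: A v.
Proof. by rewrite linearB linearZ. Qed.

Lemma diff_subZ (R : realType) (V W : normedModType R) (f g : V -> W) (c : R)
    x v : differentiable f x -> differentiable g x ->
  differentiable (fun x => f x - c *: g x) x /\
  'd (fun x => f x - c *: g x) x v = 'd f x v - c *: 'd g x v.
Proof.
move=> df dg; have dcg := differentiableZ c dg.
split; first exact: (differentiableB df dcg).
have H1 := congr1 (fun l : V -> W => l v) (diffB df dcg).
have H2 := congr1 (fun l : V -> W => l v) (diffZ c dg).
apply: etrans H1 _; rewrite /= -[X in _ = _ - X]H2 //.
Qed.

(** * Commuting flows *)

Section Transport.
Context {R : realType} {n : nat} {M : manifold R n}.
Implicit Types (a b : chart R M n) (p q : M) (x v : 'rV[R]_n).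
Variables (X Z : M -> 'rV[R]_n) (psi : R -> M -> M).
Hypotheses (CX : Ck_field 3 X) (Fpsi : is_flow X psi).

Definition bracket0 : Prop := forall a x, atlas a -> image a x ->
  differentiable (field_in a Z) x /\
  'd (field_in a Z) x (field_in a X x) = 'd (field_in a X) x (field_in a Z x).

Hypothesis XZ : bracket0.

(* [E] is the deviation of [psi u (beta h)] from its first order expansion
   along [Z]; since [DZ X = DX Z], it satisfies the linearized equation up to
   an error of order [h ^+ 2]. *)
Lemma transport_local q P r e L K beta (u : R) :
  flow_box X q P r e L K -> half_box q r (beta 0) -> moves Z beta 0 ->
  `|u| <= e -> moves Z (psi u \o beta) 0.
Proof.
move=> B hb [cb Db] ue; set a := chart_at q.
have aa : atlas a := chart_at_atlas q.
have fl p := flow_flow_line Fpsi p.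
have u0 : `|u - 0| <= e by rewrite subr0.
have start p : half_box q r p -> half_box q r (psi 0 p) by rewrite (flow0 Fpsi).
have tr p s : half_box q r p -> `|s| <= e -> dom a (psi s p) /\
    `|coord a (psi s p) - coord a q| < r.
  move=> /start[h1 h2] se; apply: (fb_trap B (fl p) h1 h2).
  by rewrite subr0.
have cpb : {for 0, continuous (psi u \o beta)}.
  by apply: continuous_comp; [exact: cb|exact: (flow_time_continuous CX Fpsi)].
apply: (@moves_chart _ _ _ _ _ _ a) => //; first exact: (tr _ u hb ue).1.
have D0 := Db a aa hb.1.
pose zeta p := field_in a Z (coord a p).
(* A bound of the initial speed with margin 1: [beta h] is within [D * |h|] of [beta 0], and the
   flow at most doubles this distance. *)
pose D := `|zeta (beta 0)| + 1.
have D_gt0 : 0 < D by rewrite ltr_wpDl.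
apply: is_derive_from_littleo => eps eps0.
have e0 := fb_e B.
(* Coefficient of [|h| ^+ 2] when Gronwall is applied to a Taylor error [K * (2 * D * |h|) ^+ 2]. *)
pose K' := 2 * e * K * (2 * D) ^+ 2.
have K'0 : 0 <= K' by rewrite !mulr_ge0 ?sqr_ge0 ?(fb_K B)// ltW.
have nb : \forall h \near (0 : R), half_box q r (beta h).
  exact: (cb _ (near_coord aa hb.1 (near_norm_lt hb.2))).
have n1 := is_derive_littleo D0 ltr01.
(* Gronwall doubles the initial deviation, hence [eps / 4]; the remaining [eps / 2] pays for the
   quadratic term. *)
have n2 := is_derive_littleo D0 (divr_gt0 eps0 (ltr0n R 4)).
have nh : \forall h \near (0 : R), `|h| * (K' + 1) <= eps / 2.
  apply/nbhs_normP; exists (eps / 2 / (K' + 1)) => /=.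
    by rewrite !divr_gt0// ltr_wpDl.
  by move=> h /=; rewrite sub0r normrN ltr_pdivlMr ?ltr_wpDl// => /ltW.
near=> h; rewrite /= add0r.
have hbh : half_box q r (beta h) by near: h.
have H1 : `|coord a (beta h) - coord a (beta 0) - h *: zeta (beta 0)| <= 1 * `|h|.
  by rewrite -{1}(add0r h); near: h.
have H2 : `|coord a (beta h) - coord a (beta 0) - h *: zeta (beta 0)| <=
    eps / 4 * `|h|.
  by rewrite -{1}(add0r h); near: h.
have Hh : `|h| * (K' + 1) <= eps / 2 by near: h.
pose x1 s := coord a (psi s (beta h)).
pose x0 s := coord a (psi s (beta 0)).
pose E s := x1 s - x0 s - h *: zeta (psi s (beta 0)).
pose f := field_in a X.
pose dE s := f (x1 s) - f (x0 s) - h *: 'd f (x0 s) (zeta (psi s (beta 0))).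
have dist s : `|s| <= e -> `|x1 s - x0 s| <= 2 * D * `|h|.
  move=> se; have := flow_box_pair (t0 := 0) (t := s) B (fl (beta h)) (fl (beta 0)).
  rewrite !(flow0 Fpsi) subr0 => /(_ hbh hb se) H.
  apply: le_trans H _; rewrite -mulrA ler_pM2l//.
  have := ler_normD (coord a (beta h) - coord a (beta 0) - h *: zeta (beta 0))
    (h *: zeta (beta 0)).
  rewrite subrK => H; apply: le_trans H _; rewrite normrZ /D.
  by rewrite mulrDl addrC (mulrC `|h|) lerD2l.
have dEs s : `|s - 0| <= e -> is_derive (s : R) (1 : R) E (dE s).
  rewrite subr0 => se; have [t1 _] := tr _ s hbh se; have [t2 r2] := tr _ s hb se.
  have I2 : image a (x0 s) by exists (psi s (beta 0)).
  have [dZ bZ] := XZ aa I2.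
  have d1 := flow_line_derive (fl (beta h)) aa t1.
  have d0 := flow_line_derive (fl (beta 0)) aa t2.
  have dz := is_derive_comp d0 dZ.
  rewrite /= -/(x0 s) bZ in dz.
  exact: (is_deriveB (is_deriveB d1 d0) (is_deriveZ h dz)).
have bound s : `|s - 0| <= e -> `|dE s| <= L * `|E s| + K * (2 * D * `|h|) ^+ 2.
  rewrite subr0 => se; have [t1 r1] := tr _ s hbh se; have [t2 r2] := tr _ s hb se.
  have -> : dE s = 'd f (x0 s) (E s) +
      (f (x1 s) - f (x0 s) - 'd f (x0 s) (x1 s - x0 s)).
    have lE : 'd f (x0 s) (E s) = 'd f (x0 s) (x1 s - x0 s) -
        h *: 'd f (x0 s) (zeta (psi s (beta 0))).
      rewrite /E (linearB ('d f (x0 s))) /=; congr (_ - _).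
      by rewrite [LHS]linearZ.
    by rewrite lE [RHS]addrC addrA subrK.
  apply: le_trans (ler_normD _ _) _; apply: lerD.
    exact: (fb_diff B).
  apply: le_trans (fb_taylor B r2 r1) _.
  apply: ler_wpM2l; first exact: fb_K B.
  by rewrite ler_sqr ?nnegrE ?dist// !mulr_ge0// ltW.
have eta0 : 0 <= K * (2 * D * `|h|) ^+ 2 by rewrite mulr_ge0 ?sqr_ge0// (fb_K B).
have := short_gronwall u0 (fb_L B) eta0 (fb_eL B) dEs bound.
have -> : E u = coord a (psi u (beta h)) - coord a (psi u (beta 0))
  - h *: zeta (psi u (beta 0)) by [].
move=> H; apply: le_trans H _.
have -> : E 0 = coord a (beta h) - coord a (beta 0) - h *: zeta (beta 0).
  by rewrite /E /x1 /x0 !(flow0 Fpsi).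
have -> : 2 * e * (K * (2 * D * `|h|) ^+ 2) = `|h| * K' * `|h|.
  by rewrite /K' !expr2; ring.
have h0 : 0 <= `|h| by [].
have : `|h| * K' <= eps / 2 by apply: le_trans Hh; rewrite ler_wpM2l// lerDl.
move: H2 h0; set A := `|_|; set B' := `|h|; move=> H2 h0 H3.
have := ler_wpM2r h0 H3; lra.
Unshelve. all: by end_near. Qed.

Lemma transport beta (s : R) : moves Z beta 0 -> moves Z (psi s \o beta) 0.
Proof.
move=> mb; move: s; apply: (@real_propagate _ (fun s => moves Z (psi s \o beta) 0) 0).
  suff -> : psi 0 \o beta = beta by [].
  by apply/funext => h /=; rewrite (flow0 Fpsi).
move=> s; set q := psi s (beta 0).
have [r [e [L [K B]]]] := flow_box_exists CX
  (@filterT _ (nbhs (coord (chart_at q) q)) _).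
have e0 := fb_e B; have r0 := fb_r B.
have : \forall u \near s, half_box q r (psi u (beta 0)).
  apply: (flow_line_continuous (flow_flow_line Fpsi (beta 0))).
  exact: nbhs_half_box.
move=> /nbhs_normP[e' /= e'0 He'].
exists (Num.min e' (e / 2)); first by rewrite lt_min e'0 divr_gt0.
move=> s1 s2; rewrite !lt_min => /andP[s1e s1e2] /andP[s2e s2e2] ms1.
have s12 : `|s2 - s1| <= e.
  by have := ler_distD s s2 s1; rewrite (distrC s s1); lra.
have -> : psi s2 \o beta = psi (s2 - s1) \o (psi s1 \o beta).
  by apply/funext => z /=; rewrite -(flowD CX Fpsi) subrK.
apply: (transport_local B) => //=.
by apply: He'; rewrite /= distrC.
Qed.

End Transport.

Section Commute.
Context {R : realType} {n : nat} {M : manifold R n}.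
Variables (X Y : M -> 'rV[R]_n) (psi phi : R -> M -> M).
Hypotheses (CX : Ck_field 3 X) (CY : Ck_field 3 Y).
Hypotheses (Fpsi : is_flow X psi) (Fphi : is_flow Y phi) (XY : commuting X Y).

Lemma Ck_field_diff k (V : M -> 'rV[R]_n) a x : Ck_field k.+1 V -> atlas a ->
  image a x -> differentiable (field_in a V) x.
Proof. by move=> CV aa; case: (CV a aa) => + _; apply. Qed.

Lemma commuting_bracket0 : bracket0 X Y.
Proof.
by move=> a x aa ax; split; [exact: (Ck_field_diff CY)|exact: XY].
Qed.

(** By [transport], [psi s] carries flow lines of [Y] to flow lines of [Y], and these are determined
    by their starting point. *)
Lemma flows_commute (s t : R) p : psi s (phi t p) = phi t (psi s p).
Proof.
have fl : flow_line Y (fun t => psi s (phi t p)).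
  move=> u.
  have m0 : moves Y (fun h => phi (h + u) p) 0.
    apply: (@moves_shift _ _ _ _ (phi ^~ p)); exact: flow_flow_line.
  have := transport CX Fpsi commuting_bracket0 s m0.
  rewrite -(subrr u) => /moves_shift.
  by under eq_fun do rewrite /= subrK.
have := @flow_line_unique _ _ _ Y _ _ 0 CY fl (flow_flow_line Fphi (psi s p)).
by rewrite !(flow0 Fphi) => /(_ erefl)/(congr1 (fun h => h t)).
Qed.

(* Transport of the constant curve at a zero of [X - c Y]. *)
Lemma collinear_flow (c t : R) p : X p = c *: Y p ->
  X (phi t p) = c *: Y (phi t p).
Proof.
move=> E; pose Z q := X q - c *: Y q.
have Zlin a : field_in a Z = (fun x => field_in a X x - c *: field_in a Y x).
  by apply/funext => x; rewrite -field_in_lin.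
have YZ : bracket0 Y Z.
  move=> a x aa ax; have dX := Ck_field_diff CX aa ax.
  have dY := Ck_field_diff CY aa ax.
  have [dZ EZ] := diff_subZ c (field_in a Y x) dX dY.
  rewrite Zlin; split; first exact: dZ.
  have H := linear_subZ ('d (field_in a Y) x) c (field_in a X x) (field_in a Y x).
  by apply: etrans EZ (etrans _ (esym H)); congr (_ - _); exact/esym/XY.
have m0 : moves Z (fun=> p) 0.
  split; first exact: cvg_cst.
  move=> a aa ap; rewrite field_inE// /Z E subrr.
  have -> : push a p 0 = 0 by rewrite /push linear0.
  exact: (is_derive_cst (coord a p) (0 : R) (1 : R)).
have [_] := transport CY Fphi YZ t m0.
set q := phi t p; move=> /(_ (chart_at q) (chart_at_atlas q) (chart_at_dom q)).
have -> : (coord (chart_at q) \o (phi t \o (fun=> p))) = cst (coord (chart_at q) q) by [].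
move=> H; have H0 := is_derive_cst (coord (chart_at q) q) (0 : R) (1 : R).
have : field_in (chart_at q) Z (coord (chart_at q) q) = 0.
  by rewrite -(derive_val (is_derive := H)) (derive_val (is_derive := H0)).
rewrite field_inE ?push_chart_at; [|exact: chart_at_atlas|exact: chart_at_dom].
by move/eqP; rewrite subr_eq0 => /eqP.
Qed.

End Commute.

(** * Flow lines crossing a transverse section *)

Section Perturbation.
Context {R : realType} {n : nat}.

Lemma mulmx_bound m (A : 'M[R]_(n, m)) :
  exists2 C, 0 < C & forall v : 'rV[R]_n, `|v *m A| <= C * `|v|.
Proof.
exists (1 + \sum_(i < n) `|(delta_mx 0 i : 'rV[R]_n) *m A|).
  by rewrite ltr_pwDl// sumr_ge0.
move=> v; apply: le_trans (linear_bound (mulmxr A) v) _.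
by rewrite ler_wpM2r// lerDr.
Qed.

Variables (G : 'rV[R]_n -> 'rV[R]_n) (A : 'M[R]_n) (C r : R).
Hypotheses (uA : A \in unitmx) (C0 : 0 < C).
Hypothesis invA : forall v : 'rV[R]_n, `|v *m invmx A| <= C * `|v|.
Hypothesis GA : forall u v : 'rV[R]_n, `|u| <= r -> `|v| <= r ->
  `|G u - G v - (u - v) *m A| <= (2 * C)^-1 * `|u - v|.

(** [u - G u *m invmx A] is the Newton map of [G] with frozen derivative [A]; its contraction factor
    is [C * (2 * C)^-1]. *)
Lemma perturbation_contraction u v : `|u| <= r -> `|v| <= r ->
  `|(u - G u *m invmx A) - (v - G v *m invmx A)| <= 2^-1 * `|u - v|.
Proof.
move=> ur vr.
have -> : (u - G u *m invmx A) - (v - G v *m invmx A) =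
    - ((G u - G v - (u - v) *m A) *m invmx A).
  rewrite mulmxBl mulmxK// mulmxBl.
  set a := G u *m _; set b := G v *m _.
  by apply/rowP => i; rewrite !mxE; ring.
rewrite normrN; apply: le_trans (invA _) _.
apply: le_trans (ler_wpM2l (ltW C0) (GA ur vr)) _.
by rewrite invfM mulrA mulrCA mulrA mulfK ?gt_eqF.
Qed.

Lemma perturbation_inj u v : `|u| <= r -> `|v| <= r -> G u = G v -> u = v.
Proof.
move=> ur vr E; have := perturbation_contraction ur vr.
rewrite E opprB addrA subrK => H.
apply/eqP; rewrite -subr_eq0 -normr_le0; lra.
Qed.

(** The Newton map preserves the ball of radius [r']: contraction uses one half of [r'], and
    [|G 0 *m invmx A|] at most the other half. Leaving [r'] free gives a zero as small as [G 0]
    permits. *)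
Lemma perturbation_zero r' : 0 < r' -> r' <= r -> `|G 0| <= r' / (2 * C) ->
  exists2 u, `|u| <= r' & G u = 0.
Proof.
move=> r'0 r'r G0; pose X : completeNormedModType R := HB.pack 'rV[R]_n (Complete.on 'rV[R]_n).
pose B := [set u : X | `|u| <= r'].
pose T u := u - G u *m invmx A.
have BB u : B u -> B (T u).
  rewrite /B /= => ur.
  have r0 : `|0 : 'rV[R]_n| <= r by rewrite normr0; lra.
  have := perturbation_contraction (le_trans ur r'r) r0; rewrite -/(T u) sub0r subr0 opprK.
  have := invA (G 0); have := ler_normD (T u + G 0 *m invmx A) (- (G 0 *m invmx A)).
  rewrite addrK normrN.
  have : C * `|G 0| <= r' / 2.
    rewrite mulrC -ler_pdivlMr//; apply: le_trans G0 _.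
    by rewrite invfM mulrA.
  lra.
pose T' : {fun B >-> B} := mkfun BB.
have cT : is_contraction T'.
  exists (2^-1)%:nng; split; first by rewrite invf_lt1// ltr1n.
  move=> [u v] /= [Bu Bv].
  by apply: perturbation_contraction; [exact: le_trans Bu r'r|exact: le_trans Bv r'r].
have cB : closed B.
  apply: compact_closed; first exact: norm_hausdorff.
  suff -> : B = [set x | `|x - 0| <= r'] by exact: compact_normed_ball.
  by apply/seteqP; split => x; rewrite /B /= subr0.
have B0 : B !=set0 by exists 0; rewrite /B /= normr0 ltW.
have [u Bu E] := @banach_fixed_point R X B T' cT cB B0.
exists u => //; move: E; rewrite /= /T => /esym/eqP.
rewrite -subr_eq0 addrAC subrr sub0r oppr_eq0 => /eqP H.
by rewrite -(mulmxKV uA (G u)) H mul0mx.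
Qed.

End Perturbation.

Section Transversal.
Context {R : realType} {M : manifold R 3}.

Lemma entry_norm n (u : 'rV[R]_n) i : `|u 0 i| <= `|u|.
Proof.
rewrite [leRHS]mx_normrE.
exact: (@le_bigmax _ _ _ 0 (fun ij => `|u ij.1 ij.2|) (0, i)).
Qed.

Lemma lsubmx_norm n m (u : 'rV[R]_(n + m)) : `|lsubmx u| <= `|u|.
Proof.
rewrite [leLHS]mx_normrE; apply/bigmax_leP; split => // -[i j] _ /=.
by rewrite (ord1 i) mxE; exact: entry_norm.
Qed.

Lemma diff_row m (V : normedModType R) (f : 'rV[R]_m -> V) z w :
  'd f z w = \sum_i w 0 i *: 'd f z (delta_mx 0 i).
Proof.
rewrite {1}(row_sum_delta w) linear_sum; apply: eq_bigr => i _.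
by rewrite [LHS]linearZ.
Qed.

Variables (g : M -> 'M[R]_3) (Y : M -> 'rV[R]_3) (phi : R -> M -> M).
Hypotheses (CY : Ck_field 3 Y) (Fphi : is_flow Y phi) (rg : riemannian g).
Variable e : 'rV[R]_2 -> M.
Hypothesis Ce : C3_embedding setT e.
Hypothesis orth : forall z i,
  bil (g (e z)) (row i (jacobian e z)) (Y (e z)) = 0.

Lemma bilDl (B : 'M[R]_3) u v w : bil B (u + v) w = bil B u w + bil B v w.
Proof. by rewrite /bil !mulmxDl mxE. Qed.

Lemma bilZl (B : 'M[R]_3) c v w : bil B (c *: v) w = c * bil B v w.
Proof. by rewrite /bil -!scalemxAl mxE. Qed.

(** Pairing with [Y] annihilates the left side by orthogonality and gives a positive multiple of [t]
    on the right; then freeness of the jacobian gives [w = 0]. *)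
Lemma jacobian_transversal z (w : 'rV[R]_2) t : Y (e z) != 0 ->
  w *m jacobian e z = t *: Y (e z) -> w = 0 /\ t = 0.
Proof.
move=> Y0 E; have [_ pos _] := rg.
have t0 : t = 0.
  have : bil (g (e z)) (w *m jacobian e z) (Y (e z)) = 0.
    rewrite mulmx_sum_row.
    elim/big_ind: _ => [|u v u0 v0|i _].
    - by rewrite /bil !mul0mx mxE.
    - by rewrite bilDl u0 v0 addr0.
    - by rewrite bilZl orth mulr0.
  rewrite E bilZl => /eqP; rewrite mulf_eq0 (gt_eqF (pos _ _ Y0)) orbF.
  by move/eqP.
split => //; move: E; rewrite t0 scale0r => E.
have [_ free _] := Ce.
have /row_freeP[D JD] := free z I.
by rewrite -(mulmx1 w) -JD mulmxA E mul0mx.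
Qed.

(** The smooth expression [h] of [e] lives in a chart [b] provided by [Ck_map], whereas the jacobian
    is computed in the preferred chart; the last clause links the two. *)
Lemma embedding_chart z0 : exists b (h : 'rV[R]_2 -> 'rV[R]_3) (A : set 'rV[R]_2),
  [/\ atlas b /\ dom b (e z0), open A /\ A z0, Ck_on 1 A h,
    forall z, A z -> dom b (e z) /\ coord b (e z) = h z &
    forall w, 'd (coord (chart_at (e z0)) \o e) z0 w =
      'd (coord (chart_at (e z0)) \o icoord b) (coord b (e z0)) ('d h z0 w)].
Proof.
have [Cmap _ _] := Ce; have [a [b [-> ab _ be [A [h [oA Az Ch H]]]]]] := Cmap z0 I.
have Ch1 := Ck_onW (Ck_onW Ch).
have Hb z : A z -> dom b (e z) /\ coord b (e z) = h z by move=> /(H z I I).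
exists b, h, A; split => // w.
have ac := chart_at_atlas (e z0); have dc := chart_at_dom (e z0).
apply: near_diff_comp.
- have : \forall z \near z0, A z by apply: open_nbhs_nbhs.
  apply: filterS => z /Hb[bz <-] /=; by rewrite coordK.
- by case: (Hb z0 Az).
- by case: Ch1 => + _; apply.
- exact: transition_diff.
Qed.

Lemma row_mx_norm (w : 'rV[R]_2) (t : R) (r : R) : 0 <= r -> `|w| <= r ->
  `|t| <= r -> `|row_mx w (@const_mx _ 1 1 t)| <= r.
Proof.
move=> r0 wr tr; rewrite [leLHS]mx_normrE; apply/bigmax_leP; split => //.
move=> -[i j] _ /=; rewrite (ord1 i) mxE; case: splitP => k _.
  exact: le_trans (entry_norm w k) wr.
by rewrite mxE.
Qed.

(** A quantitative implicit function theorem for [h (z0 + w) - coord b (phi t p)], whose small zeros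
    [(w, t)] are crossings of the section by the flow line of [p]. Its distance to a fixed linear
    map is controlled uniformly in [p] near [e z0]: injectivity then gives uniqueness of the
    crossing time, and the fixed point gives a crossing at small time. *)
Lemma section_transversal z0 : Y (e z0) != 0 ->
  exists2 d : R, 0 < d &
    (\forall p \near e z0, forall t t', `|t| < d -> `|t'| < d ->
      range e (phi t p) -> range e (phi t' p) -> t = t') /\
    forall d' : R, 0 < d' -> \forall p \near e z0,
      exists2 t, `|t| < d' & range e (phi t p).
Proof.
move=> Y0; set q := e z0.
have [b [h [A [[ab bq] [oA Az] Ch1 Hh Jh]]]] := embedding_chart z0.
have [dh _] := Ch1.
pose f0 := field_in b Y (coord b q).
pose Jm : 'M[R]_(2, 3) := \matrix_i 'd h z0 (delta_mx 0 i).
(* The differential in [(w, t)] at the origin when [p = q]. *)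
pose B : 'M[R]_(2 + 1, 3) := col_mx Jm (- f0).
have JmE w : w *m Jm = 'd h z0 w.
  rewrite diff_row mulmx_sum_row; apply: eq_bigr => i _.
  by rewrite rowK.
have BE (u : 'rV[R]_(2 + 1)) : u *m B = 'd h z0 (lsubmx u) - rsubmx u 0 0 *: f0.
  rewrite -{1}(hsubmxK u) mul_row_col JmE mulmxN; congr (_ - _).
  by rewrite {1}(mx11_scalar (rsubmx u)) mul_scalar_mx.
have uB : (B : 'M[R]_3) \in unitmx.
  rewrite -row_free_unit -kermx_eq0; apply/rowV0P => v /sub_kermxP.
  move=> vB; have {vB} : (v : 'rV[R]_(2 + 1)) *m B = 0 by [].
  rewrite BE => /eqP; rewrite subr_eq0 => /eqP E.
  set w := lsubmx _ in E; set t := rsubmx _ 0 0 in E.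
  have ac := chart_at_atlas q; have dc := chart_at_dom q.
  have : w *m jacobian e z0 = t *: Y q.
    have -> : w *m jacobian e z0 = 'd (coord (chart_at q) \o e) z0 w.
      rewrite diff_row mulmx_sum_row; apply: eq_bigr => i _.
      by rewrite rowK.
    have Yq : Y q = 'd (coord (chart_at q) \o icoord b) (coord b q) f0.
      by rewrite -{1}(push_chart_at q (Y q)) (push_change _ ab ac bq dc) -field_inE.
    by rewrite Jh E [LHS]linearZ Yq.
  move/(jacobian_transversal Y0) => [w0 t0].
  rewrite -[v](hsubmxK (v : 'rV[R]_(2 + 1))) -/w w0.
  have -> : rsubmx (v : 'rV[R]_(2 + 1)) = 0.
    by apply/matrixP => i j; rewrite !ord1 [LHS]t0 mxE.
  by apply/rowP => j; rewrite [LHS](_ : _ = (0 : 'rV[R]_(2 + 1)) 0 j) ?row_mx0 ?mxE.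
have [C C0 HC] := mulmx_bound (invmx (B : 'M[R]_3)).
(* The section and the flow each contribute an error with coefficient [k], and
   [k + k = (2 * C)^-1]. *)
pose k := (4 * C)^-1.
have k0 : 0 < k by rewrite invr_gt0 mulr_gt0.
have cf : {for coord b q, continuous (field_in b Y)}.
  by apply: differentiable_continuous; apply: (Ck_field_diff CY ab); exists q.
have cphi := flow_continuous CY Fphi.
have near_phi (O : set M) : nbhs q O -> exists N : set R * set M,
    [/\ nbhs (0 : R) N.1, nbhs q N.2 &
      forall t p, N.1 t -> N.2 p -> O (phi t p)].
  move=> nO; have := cphi ((0 : R), q); rewrite /continuous_at /= (flow0 Fphi).
  move=> /(_ _ nO) [N [N1 N2] HN]; exists N; split => // t p tN pN.
  exact: (HN (t, p)).
have nf : \forall p \near q, dom b p /\ `|field_in b Y (coord b p) - f0| <= k.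
  apply: (@near_coord _ _ _ b q [set x | `|field_in b Y x - f0| <= k] ab bq).
  by have /cvgrPdist_le/(_ _ k0) := cf; apply: filterS => x; rewrite distrC.
have [[N1 N2] [/= N1n N2n HN]] := near_phi _ nf.
have nA : nbhs z0 A by apply: open_nbhs_nbhs.
have /filter_ex[r [[[r0 rA] rN] rh]] : \forall r \near 0^'+, ((0 < r /\
    (forall z, `|z - z0| < r -> A z)) /\ (forall t : R, `|t - 0| < r -> N1 t)) /\
    (forall x y, `|x - z0| < r -> `|y - z0| < r ->
      `|h y - h x - 'd h z0 (y - x)| <= k * `|y - x|).
  apply: filterI; last exact: (C1_strict oA Az Ch1 k0).
  apply: filterI; last exact: (@near_ball R R^o).
  by apply: filterI; [exact: nbhs_right_gt|exact: near_ball].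
(* Times between [t] and [t'] are reached from [t'] by at most [|t - t'| <= 2 * r2], hence stay
   below [3 * r2 < r]. *)
pose r2 := r / 4; have r20 : 0 < r2 by rewrite divr_gt0.
pose G p (u : 'rV[R]_3) := h (z0 + lsubmx (u : 'rV[R]_(2 + 1))) -
  coord b (phi (rsubmx (u : 'rV[R]_(2 + 1)) 0 0) p).
have sub_r (u : 'rV[R]_3) : `|u| <= r2 ->
    `|z0 + lsubmx (u : 'rV[R]_(2 + 1)) - z0| < r /\
    `|rsubmx (u : 'rV[R]_(2 + 1)) 0 0| <= r2.
  move=> ur; split; last by rewrite mxE; exact: le_trans (entry_norm u _) ur.
  rewrite addrAC subrr add0r.
  have := lsubmx_norm (u : 'rV[R]_(2 + 1)); rewrite /r2 in ur; lra.
have flow_strict p t t' : N2 p -> `|t| <= r2 -> `|t'| <= r2 ->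
    `|coord b (phi t p) - coord b (phi t' p) - (t - t') *: f0| <= k * `|t - t'|.
  move=> Np tr tr'.
  have Nin s : `|s - t'| <= `|t - t'| -> N1 s.
    move=> st; apply: rN; rewrite subr0.
    have := ler_normD (s - t') t'; rewrite subrK.
    have := ler_normB t t'; rewrite /r2 in tr tr'; lra.
  pose c s := coord b (phi s p) - s *: f0.
  have -> : coord b (phi t p) - coord b (phi t' p) - (t - t') *: f0 = c t - c t'.
    by rewrite /c scalerBl; apply/rowP => i; rewrite !mxE; ring.
  apply: (@mvt_rV_abs _ _ c (fun s => field_in b Y (coord b (phi s p)) - f0)
    t' `|t - t'|) => //; first exact: ltW.
    move=> s /Nin sN; have [bs _] := HN _ _ sN Np.
    have := is_derive_line s 0 f0; under eq_fun do rewrite add0r.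
    move=> H; exact: (is_deriveB (flow_line_derive (flow_flow_line Fphi p) ab bs) H).
  by move=> s /Nin sN; have [_ ] := HN _ _ sN Np.
have GA p : N2 p -> forall u v : 'rV[R]_3, `|u| <= r2 -> `|v| <= r2 ->
    `|G p u - G p v - (u - v) *m (B : 'M[R]_3)| <= (2 * C)^-1 * `|u - v|.
  move=> Np u v ur vr.
  have [u1 u2] := sub_r u ur; have [v1 v2] := sub_r v vr.
  have := rh _ _ v1 u1; have := flow_strict p _ _ Np u2 v2.
  rewrite -[_ *m _]/((u - v : 'rV[R]_(2 + 1)) *m B) BE /G.
  set uv : 'rV[R]_(2 + 1) := u - v.
  have El : lsubmx uv = lsubmx (u : 'rV[R]_(2 + 1)) - lsubmx (v : 'rV[R]_(2 + 1)).
    by apply/rowP => i; rewrite !mxE.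
  have Er : rsubmx uv 0 0 =
      rsubmx (u : 'rV[R]_(2 + 1)) 0 0 - rsubmx (v : 'rV[R]_(2 + 1)) 0 0.
    by rewrite !mxE.
  have wuv := lsubmx_norm uv; have tuv : `|rsubmx uv 0 0| <= `|uv|.
    by rewrite mxE; exact: entry_norm.
  rewrite El in wuv *; rewrite Er in tuv *.
  rewrite opprD addrACA subrr add0r.
  move: wuv tuv.
  set w := lsubmx (u : 'rV[R]_(2 + 1)); set w' := lsubmx (v : 'rV[R]_(2 + 1)).
  set t := rsubmx (u : 'rV[R]_(2 + 1)) 0 0.
  set t' := rsubmx (v : 'rV[R]_(2 + 1)) 0 0.
  move=> wuv tuv.
  set ct := coord b _; set ct' := coord b _; set hw := h _; set hw' := h _.
  move=> Ft Fw.
  have -> : hw - ct - (hw' - ct') - ('d h z0 (w - w') - (t - t') *: f0) =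
      (hw - hw' - 'd h z0 (w - w')) - (ct - ct' - (t - t') *: f0).
    by set x := 'd _ _ _; apply/rowP => i; rewrite !mxE; ring.
  apply: le_trans (ler_normB _ _) _.
  have kuv : k * `|w - w'| + k * `|t - t'| <= (2 * C)^-1 * `|uv|.
    have -> : (2 * C)^-1 = k + k by rewrite /k !invfM; lra.
    by rewrite mulrDl lerD// ler_wpM2l// ltW.
  exact: le_trans (lerD Fw Ft) kuv.
have Gzero p u : N2 p -> `|u| <= r2 -> G p u = 0 ->
    e (z0 + lsubmx (u : 'rV[R]_(2 + 1))) = phi (rsubmx (u : 'rV[R]_(2 + 1)) 0 0) p.
  move=> Np ur; have [u1 u2] := sub_r u ur.
  rewrite /G; have [bu <-] := Hh _ (rA _ u1); move=> /eqP; rewrite subr_eq0 => /eqP E.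
  have [|bp _] := HN (rsubmx (u : 'rV[R]_(2 + 1)) 0 0) p _ Np.
    by apply: rN; rewrite subr0 /r2 in u2 *; lra.
  by rewrite -(coordK ab bu) -(coordK ab bp) E.
have zeroG p t z : N2 p -> `|t| <= r2 -> `|z - z0| <= r2 -> e z = phi t p ->
    G p (row_mx (z - z0) (@const_mx _ 1 1 t)) = 0.
  move=> Np tr zr E; rewrite /G row_mxKl row_mxKr mxE [z0 + _]addrC subrK -E.
  have [|_ ->] := Hh z; last by rewrite subrr.
  by apply: rA; rewrite /r2 in zr *; lra.
(* The section might come back near [e z0] with parameters far from [z0], where [G p] says nothing;
   openness of the embedding onto its image excludes this. *)
have [_ _ [_ _ Oe]] := Ce.
have [OM oOM EOM] := Oe (ball z0 r2) (ball_open _ _).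
have OMq : nbhs q OM.
  apply: open_nbhs_nbhs; split => //.
  have : (e @` (ball z0 r2 `&` setT)) q by exists z0 => //; split => //; exact: ballxx.
  by rewrite EOM => -[].
have [[N3 N4] [/= N3n N4n HN']] := near_phi _ OMq.
have /filter_ex[d3 [d30 dN3]] : \forall d \near 0^'+, 0 < d /\
    (forall t : R, `|t - 0| < d -> N3 t).
  by apply: filterI; [exact: nbhs_right_gt|exact: (@near_ball R R^o)].
exists (Num.min r2 d3); first by rewrite lt_min r20.
split.
  apply: filterS2 N2n N4n => p Np N4p t t'; rewrite !lt_min.
  move=> /andP[tr td] /andP[tr' td'] Rt Rt'.
  have lift s : `|s| < r2 -> `|s| < d3 -> range e (phi s p) ->
      exists2 z, `|z - z0| <= r2 & e z = phi s p.
    move=> sr sd Rs; have : (OM `&` e @` setT) (phi s p).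
      by split => //; apply: HN' => //; apply: dN3; rewrite subr0.
    rewrite -EOM => -[z [zr _] ez]; exists z => //.
    by move: zr; rewrite -ball_normE /= distrC => /ltW.
  have [z zr ez] := lift t tr td Rt; have [z' zr' ez'] := lift t' tr' td' Rt'.
  have E : G p (row_mx (z - z0) (@const_mx _ 1 1 t)) =
      G p (row_mx (z' - z0) (@const_mx _ 1 1 t')).
    by rewrite !zeroG ?(ltW tr) ?(ltW tr').
  have := perturbation_inj uB C0 HC (GA p Np) _ _ E.
  move/(_ (row_mx_norm (ltW r20) zr (ltW tr)) (row_mx_norm (ltW r20) zr' (ltW tr'))).
  move/(congr1 (fun v : 'rV[R]_(2 + 1) => rsubmx v 0 0)).
  by rewrite /= !row_mxKr !mxE.
move=> d' d'0; pose r' := Num.min r2 (d' / 2).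
have r'0 : 0 < r' by rewrite lt_min r20 divr_gt0.
have r'r : r' <= r2 by rewrite ge_min lexx.
have r'd : r' < d' by rewrite gt_min; apply/orP; right; lra.
have e0 : 0 < r' / (2 * C) by rewrite divr_gt0// mulr_gt0.
have close : `|coord b q - coord b q| < r' / (2 * C) by rewrite subrr normr0.
apply: filterS2 N2n (near_coord ab bq (near_norm_lt close)) => p Np [_ pq].
have [|u ur Gu] := perturbation_zero uB C0 HC (GA p Np) r'0 r'r.
  rewrite /G linear0 addr0 linear0 mxE (flow0 Fphi).
  by have [_ <-] := Hh _ Az; rewrite distrC ltW.
have ur2 := le_trans ur r'r.
exists (rsubmx (u : 'rV[R]_(2 + 1)) 0 0).
  by apply: le_lt_trans r'd; rewrite mxE; exact: le_trans (entry_norm u _) ur.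
by exists (z0 + lsubmx (u : 'rV[R]_(2 + 1))) => //; exact: Gzero.
Qed.

End Transversal.

(** * Local stable manifolds and collinear points *)

Lemma interval_uncountable (R : realType) (a b : R) : a < b ->
  ~ countable `]a, b[%classic.
Proof.
move=> ab /countable_lebesgue_measure0; rewrite lebesgue_measure_itv /= lte_fin ab.
by move=> /eqP; rewrite -EFinB eqe subr_eq0 gt_eqF.
Qed.

(* Each value of [f] other than the prescribed one is taken on a nondegenerate
   connected set, whose [k]-image contains a rational: countably many values. *)
Lemma constant_on_arc (R : realType) (T : topologicalType) (A : set T)
    (k f : T -> R) (c : R) y0 :
  connected A -> {within A, continuous k} -> {within A, continuous f} ->
  set_inj A k -> A y0 -> f y0 = c ->
  (forall y, A y -> f y <> c -> exists C, [/\ C `<=` A, connected C,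
    (forall z, C z -> f z = f y) & exists p q, [/\ C p, C q & p <> q]]) ->
  forall y, A y -> f y = c.
Proof.
move=> cA ck cf kinj Ay0 fy0 H y1 Ay1; apply: contrapT => fy1.
have cfA : connected (f @` A) by exact: connected_continuous_connected.
have /connected_intervalP itv := cfA.
pose a := Num.min c (f y1); pose b := Num.max c (f y1).
have ab : a < b.
  by rewrite /a /b; case: (ltgtP c (f y1)) => // E; case: fy1.
have fa : (f @` A) a.
  by rewrite /a minEle; case: ifP => _; [exists y0|exists y1].
have fb : (f @` A) b.
  by rewrite /b maxEle; case: ifP => _; [exists y1|exists y0].
(* A rational attached to each intermediate value [v]: the [k]-coordinate of a point where [f]
   equals [v]. Outside the interval, 0 is a dummy. *)
have Hq v : exists q : rat, a < v < b ->
    exists z, [/\ A z, f z = v & k z = ratr q].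
  have [vab|] := boolP (a < v < b); last by move=> ?; exists 0.
  have [y Ay fy] : (f @` A) v.
    by move/andP: vab => [av vb]; apply: (itv _ _ fa fb); rewrite !ltW.
  have fyc : f y <> c.
    move=> E; move: vab; rewrite -fy E /a /b => /andP[].
    by case: (ltgtP c (f y1)) => // *; lra.
  have [C [CA cC fC [p [q [Cp Cq pq]]]]] := H y Ay fyc.
  have cCk : connected (k @` C).
    apply: connected_continuous_connected => //.
    exact: continuous_subspaceW CA ck.
  have /connected_intervalP itvC := cCk.
  wlog kpq : p q Cp Cq pq / k p < k q.
    move=> W; case: (ltgtP (k p) (k q)) => [|kqp|E]; first exact: W.
      by apply: (W q p) => // /esym.
    by case: pq; apply: kinj; rewrite ?inE//; exact: CA.
  have [r] := rat_in_itvoo kpq; rewrite in_itv /= => /andP[pr rq].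
  exists r => _.
  have [z Cz kz] : (k @` C) (ratr r).
    by apply: (itvC (k p) (k q)); [exists p|exists q|rewrite !ltW].
  by exists z; split => //; [exact: CA|rewrite fC].
have [q qP] := choice Hq.
apply: (@interval_uncountable R a b ab).
apply/countable_injP; exists (pickle \o q) => v w.
rewrite !inE /= !in_itv /= => vab wab /(pcan_inj pickleK) E.
(* Equal rationals give equal [k]-coordinates, hence the same point of the arc and the same value of
   [f]. *)
have [z [Az fz kz]] := qP v vab; have [z' [Az' fz' kz']] := qP w wab.
by rewrite -fz -fz'; congr f; apply: kinj; rewrite ?inE// kz kz' E.
Qed.

Section PairFlow.
Context {R : realType} {n : nat} {M : manifold R n}.
Variables (X Y : M -> 'rV[R]_n) (psi phi : R -> M -> M).
Hypotheses (CX : Ck_field 3 X) (CY : Ck_field 3 Y).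
Hypotheses (Fpsi : is_flow X psi) (Fphi : is_flow Y phi) (XY : commuting X Y).

Definition collinear (c : R) : set M := [set p | X p = c *: Y p].

Lemma closed_collinear c : closed (collinear c).
Proof.
rewrite -openC openE => p /= Zp.
have aa := chart_at_atlas p; have ap := chart_at_dom p.
set a := chart_at p in aa ap.
pose F x := field_in a X x - c *: field_in a Y x.
have cF : {for coord a p, continuous F}.
  have ai : image a (coord a p) by exists p.
  have [D _] := diff_subZ c 0 (Ck_field_diff CX aa ai) (Ck_field_diff CY aa ai).
  exact: differentiable_continuous.
have F0 : F (coord a p) != 0.
  apply/eqP => /eqP; rewrite /F !field_inE// /a !push_chart_at subr_eq0 => /eqP.
  exact: Zp.
have nF : \forall x \near coord a p, F x != 0.
  exact: cvgr_neq0 cF F0.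
apply: filterS (near_coord aa ap nF) => q [aq] + Zq.
rewrite /F !field_inE// Zq => /eqP; apply.
have := push_lin a q c (Y q) 0; rewrite !addr0 => ->.
by rewrite /push linear0 addr0 subrr.
Qed.

(** Collinearity with factor [c] persists along the [phi]-orbit, so this orbit run at speed [c] is a
    flow line of [X]. *)
Lemma psi_collinear c b p : collinear c p -> psi b p = phi (c * b) p.
Proof.
move=> Zp.
have fl : flow_line X (fun b => phi (c * b) p).
  move=> t.
  have Dl : is_derive (t : R) (1 : R) (fun b : R => c * b) c.
    have := @is_derive_line R R^o t 0 c.
    by under eq_fun do rewrite add0r [_ *: c]mulrC.
  have cl : {for t, continuous (fun b : R => c * b)}.
    by apply/differentiable_continuous/derivable1_diffP; case: Dl.
  have [cc D] := flow_flow_line Fphi p (c * t).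
  split; first exact: (@continuous_comp _ _ _ (fun b : R => c * b) (phi^~ p) t cl cc).
  move=> a aa ap; have [/derivable1_diffP Da ED] := D a aa ap.
  have := is_derive_comp Dl Da.
  have -> : 'd (coord a \o phi^~ p) (c * t) c =
      field_in a X (coord a (phi (c * t) p)); last by [].
  rewrite -[X in 'd _ _ X]mulr1 [LHS]linearZ /= -deriveE// ED !field_inE//.
  rewrite (collinear_flow CX CY Fphi XY _ Zp).
  have := push_lin a (phi (c * t) p) c (Y (phi (c * t) p)) 0.
  by rewrite !addr0 => ->; rewrite /push linear0 addr0.
have := flow_line_unique CX fl (flow_flow_line Fpsi p) (t0 := 0).
by rewrite mulr0 !(flow0 Fphi) !(flow0 Fpsi) => /(_ erefl)/(congr1 (fun h => h b)).
Qed.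

Lemma periodic_orbit_flow gamma : periodic_orbit Y setT gamma ->
  compact gamma /\ forall a p, gamma p -> gamma (phi a p).
Proof.
move=> [s [T [T0 Is sT _ ->]]].
have fs := flow_line_integral Is.
have sE t : s t = phi t (s 0).
  have := flow_line_unique CY fs (flow_flow_line Fphi (s 0)) (t0 := 0).
  by rewrite (flow0 Fphi) => /(_ erefl) {1}->.
split; last first.
  by move=> a _ [t _ <-]; exists (a + t) => //; rewrite sE (sE t) (flowD CY Fphi).
have sk k t : s (t + k%:R * T) = s t.
  elim: k => [|k IH]; first by rewrite mul0r addr0.
  by rewrite -natr1 mulrDl mul1r addrA sT.
have E : range s = s @` `[0, T]%classic.
  apply/seteqP; split => _ [t tT <-]; last by exists t.
  (* Enough periods are added to make the time nonnegative, as required for taking its integer part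
     with [truncn_itv]. *)
  have [u u0 <-] : exists2 u, 0 <= u & s u = s t.
    exists (t + (Num.truncn (`|t| / T)).+1%:R * T); last exact: sk.
    have : `|t| / T < (Num.truncn (`|t| / T)).+1%:R by exact: truncnS_gt.
    by rewrite ltr_pdivrMr// => H; have := ler_norm (- t); rewrite normrN; lra.
  have uT : 0 <= u / T by rewrite divr_ge0// ltW.
  pose m := Num.truncn (u / T).
  exists (u - m%:R * T); last by rewrite -(sk m) subrK.
  have /andP[m1 m2] := truncn_itv uT; rewrite -/m in m1 m2.
  rewrite /= in_itv /= subr_ge0 -ler_pdivlMr// m1 /= lerBlDr.
  by move: m2; rewrite ltr_pdivrMr// -natr1 mulrDl mul1r addrC => /ltW.
rewrite E; apply: continuous_compact; last exact: segment_compact.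
by apply: continuous_subspaceT; exact: flow_line_continuous fs.
Qed.

End PairFlow.

(** * Basins of periodic orbits, for a flow or its reversal *)

Section LocalStable.
Context {R : realType} {n : nat} {M : manifold R n}.
Variables (Phi psi : R -> M -> M).
Hypothesis cPhi : continuous (fun z : R * M => Phi z.1 z.2).
Hypothesis cpsi : continuous (fun z : R * M => psi z.1 z.2).
Hypotheses (Phi0 : forall p, Phi 0 p = p) (psi0 : forall p, psi 0 p = p).
Hypothesis PhiD : forall s t p, Phi (t + s) p = Phi t (Phi s p).
Hypothesis Phi_psi : forall s t p, psi s (Phi t p) = Phi t (psi s p).

Lemma Phi_time_continuous t : continuous (Phi t).
Proof.
move=> p; apply: (@continuous_comp M (R * M)%type M (fun p => (t, p))
  (fun z => Phi z.1 z.2)); last exact: cPhi.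
exact: (cvg_pair (cvg_cst _) cvg_id).
Qed.

Lemma psi_time_continuous t : continuous (psi t).
Proof.
move=> p; apply: (@continuous_comp M (R * M)%type M (fun p => (t, p))
  (fun z => psi z.1 z.2)); last exact: cpsi.
exact: (cvg_pair (cvg_cst _) cvg_id).
Qed.

Lemma Phi_orbit_continuous p : continuous (Phi ^~ p).
Proof.
move=> t; apply: (@continuous_comp R (R * M)%type M (fun t => (t, p))
  (fun z => Phi z.1 z.2)); last exact: cPhi.
exact: (cvg_pair cvg_id (cvg_cst _)).
Qed.

Lemma near_Phi_psi (V : set M) (p : M) : nbhs p V ->
  exists2 O : set M, nbhs p O & \forall d \near 0^'+,
    forall p', O p' -> forall a b : R, `|a| < d -> `|b| < d ->
    V (Phi a (psi b p')).
Proof.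
move=> pV.
have := @cPhi (0, psi 0 p); rewrite /continuous_at /= Phi0 psi0 => /(_ _ pV).
move=> [[A O] /= [A0 Op] HAO].
have := @cpsi (0, p); rewrite /continuous_at /= psi0 => /(_ _ Op).
move=> [[B O2] /= [B0 O2p] HBO].
have H : \forall d \near 0^'+, forall t : R, `|t| < d -> A t /\ B t.
  have AB0 : nbhs (0 : R^o) (A `&` B) by exact: filterI.
  by apply: filterS (near_ball AB0) => d Hd t td; apply: Hd; rewrite subr0.
exists O2 => //; apply: filterS H => d Hd p' O2p' a b ad bd.
by apply: (HAO (a, _)); split; [case: (Hd a)|apply: (HBO (b, _)); split; [case: (Hd b)|]].
Qed.

(** Compactness makes the admissible short times uniform, on a whole neighbourhood [O] of [C]:
    converging orbits come close to [gamma] without having to meet it. *)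
Lemma tube (C V : set M) : compact C -> open V -> C `<=` V ->
  exists2 d : R, 0 < d & exists O, [/\ open O, C `<=` O &
    forall p, O p -> forall a b : R, `|a| < d -> `|b| < d -> V (Phi a (psi b p))].
Proof.
move=> /compact_near_coveringP cC oV CV.
pose P (d : R) (p : M) := \forall p' \near p, forall a b : R, `|a| < d -> `|b| < d ->
  V (Phi a (psi b p')).
have : \forall d \near 0^'+, C `<=` P d.
  apply: cC => p Cp.
  have [A Ap HA] := near_Phi_psi (open_nbhs_nbhs (conj oV (CV _ Cp))).
  exists (A°, [set d | forall p', A p' -> forall a b : R, `|a| < d ->
    `|b| < d -> V (Phi a (psi b p'))]) => /=.
    by split => //; exact: nbhs_interior.
  move=> [p' d] /= [Ap' Bd].
  by apply: filterS Ap' => q Aq; exact: Bd.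
move=> H; have /filter_ex[d [d0 CP]] : \forall d \near 0^'+, 0 < d /\ C `<=` P d.
  by apply: filterI => //; exact: nbhs_right_gt.
exists d => //.
exists (interior [set p | forall a b : R, `|a| < d -> `|b| < d -> V (Phi a (psi b p))]).
split; [exact: open_interior|by move=> p /CP|].
by move=> p /interior_subset.
Qed.

Definition basin (V gamma : set M) := [set p |
  (forall t, 0 <= t -> V (Phi t p)) /\ converges_to Phi p gamma].

(** The displacement commutes with [Phi]. After time [T] the orbit is in a tube around [gamma],
    before [T] it is a compact arc of [V]; each part tolerates small displacements. Convergence
    survives because [gamma] is invariant, so the preimage of a neighbourhood of [gamma] under the
    displacement is again one. *)
Lemma basin_invariant (V gamma : set M) y : open V -> gamma `<=` V ->
  compact gamma ->
  (forall a p, gamma p -> gamma (Phi a p)) ->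
  (forall b p, gamma p -> gamma (psi b p)) ->
  basin V gamma y ->
  \forall d \near 0^'+, forall a b : R, `|a| < d -> `|b| < d ->
    basin V gamma (Phi a (psi b y)).
Proof.
move=> oV gV cg Pg pg [yV yg].
have [d1 d10 [Q1 [oQ1 gQ1 HQ1]]] := tube cg oV gV.
have [T HT] := yg _ oQ1 gQ1.
have cC : compact ((Phi ^~ y) @` `[0, T]%classic).
  apply: continuous_compact; last exact: segment_compact.
  by apply: continuous_subspaceT; exact: Phi_orbit_continuous.
have CV : (Phi ^~ y) @` `[0, T]%classic `<=` V.
  by move=> _ [t + <-]; rewrite /= in_itv /= => /andP[t0 _]; exact: yV.
have [d2 d20 [Q2 [oQ2 CQ2 HQ2]]] := tube cC oV CV.
near=> d => a b ad bd.
have dd1 : d <= d1 by near: d; exact: nbhs_right_le.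
have dd2 : d <= d2 by near: d; exact: nbhs_right_le.
have comm t : Phi t (Phi a (psi b y)) = Phi a (psi b (Phi t y)).
  by rewrite Phi_psi -!PhiD addrC.
split=> [t t0|O oO gO].
  rewrite comm; have [tT|Tt] := leP t T.
    apply: HQ2; [|exact: lt_le_trans dd2|exact: lt_le_trans dd2].
    by apply: CQ2; exists t => //; rewrite /= in_itv /= t0 tT.
  apply: HQ1; [|exact: lt_le_trans dd1|exact: lt_le_trans dd1].
  by apply: HT; exact: ltW.
pose Q' := [set p | O (Phi a (psi b p))].
have oOp : open Q'.
  apply: (@open_comp _ _ (fun p => Phi a (psi b p))) => // p _.
  apply: (@continuous_comp _ _ _ (psi b)); first exact: psi_time_continuous.
  exact: Phi_time_continuous.
have [|T' HT'] := yg Q' oOp; first by move=> p gp; apply/gO/Pg/pg.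
by exists T' => t tT; rewrite comm; exact: HT'.
Unshelve. all: by end_near. Qed.

(** Otherwise the complement of [Q] would be a neighbourhood of [gamma], which the orbit would have
    to enter. *)
Lemma basin_closed (V gamma Q : set M) y : basin V gamma y -> closed Q ->
  (forall t, Q (Phi t y)) -> exists2 p, gamma p & Q p.
Proof.
move=> [_ yg] cQ Qy; apply: contrapT => H.
have [||T HT] := yg (~` Q); first exact: closed_openC.
  by move=> p gp Qp; apply: H; exists p.
exact: (HT T (lexx _)).
Qed.

End LocalStable.

(** * Projection of orbits to a section along a commuting flow *)

Section SectionPath.
Context {R : realType} {n : nat} {M : manifold R n}.
Variables (X Y : M -> 'rV[R]_n) (psi phi : R -> M -> M).
Hypotheses (CX : Ck_field 3 X) (CY : Ck_field 3 Y).
Hypotheses (Fpsi : is_flow X psi) (Fphi : is_flow Y phi) (XY : commuting X Y).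

(** The conclusion of [section_transversal], freed from the embedding: the window [d] of uniqueness
    is fixed before the precision [d'] of existence. *)
Definition transversal_at (S : set M) (q : M) : Prop :=
  exists2 d : R, 0 < d &
    (\forall p \near q, forall t t', `|t| < d -> `|t'| < d ->
      S (phi t p) -> S (phi t' p) -> t = t') /\
    forall d' : R, 0 < d' -> \forall p \near q,
      exists2 t, `|t| < d' & S (phi t p).

Lemma pair_cvg (a b : R -> R) (y : M) (s0 : R) : {for s0, continuous a} ->
  {for s0, continuous b} ->
  {for s0, continuous (fun s => phi (a s) (psi (b s) y))}.
Proof.
move=> ca cb; apply: (@continuous_comp R (R * M)%type M
  (fun s => (a s, psi (b s) y)) (fun z => phi z.1 z.2)).
  have cpb : {for s0, continuous (fun s => psi (b s) y)}.
    apply: (@continuous_comp _ _ _ b (psi^~ y)); first exact: cb.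
    exact: (flow_line_continuous (flow_flow_line Fpsi y)).
  exact: (cvg_pair ca cpb).
exact: (flow_continuous CY Fphi).
Qed.

(** A zero of [Y] is a collinear point with factor 0, for the pair [(Y, Y)] along [phi] and for the
    pair [(Y, X)] along [psi]. *)
Lemma zero_flow p t s : Y (phi t (psi s p)) = 0 -> Y p = 0.
Proof.
move=> Y0.
have H1 := @collinear_flow _ _ _ Y Y phi CY CY Fphi (fun _ _ _ _ => erefl)
  0 (- t) (phi t (psi s p)).
have {H1} : Y (psi s p) = 0.
  have := H1; rewrite scale0r Y0 => /(_ erefl).
  by rewrite scale0r -(flowD CY Fphi) addrC subrr (flow0 Fphi).
move=> Y1.
have YX : commuting Y X by move=> a x aa ax; exact: (esym (XY aa ax)).
have := @collinear_flow _ _ _ Y X psi CY CX Fpsi YX 0 (- s) (psi s p).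
rewrite scale0r Y1 => /(_ erefl).
by rewrite scale0r -(flowD CX Fpsi) addrC subrr (flow0 Fpsi).
Qed.

(** [theta s] is the small time after which [psi s y] meets [S]. Continuity at [s0] combines
    transversality at the point reached, which gives a nearby crossing, with uniqueness at [y],
    which identifies its time as [theta s]. *)
Lemma section_path (S : set M) y : S y -> Y y != 0 ->
  (forall q, S q -> Y q != 0 -> transversal_at S q) ->
  exists sigma theta, [/\ 0 < sigma, theta 0 = 0,
    forall s : R, `|s| < sigma -> S (phi (theta s) (psi s y)) &
    forall s : R, `|s| < sigma -> {for s, continuous theta}].
Proof.
move=> Sy Y0 T; have [d d0 [uniq exi]] := T y Sy Y0.
have cpsi := flow_line_continuous (flow_flow_line Fpsi y).
have near_y : \forall s \near (0 : R),
    (forall t t', `|t| < d -> `|t'| < d -> S (phi t (psi s y)) ->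
      S (phi t' (psi s y)) -> t = t') /\
    exists2 t, `|t| < d & S (phi t (psi s y)).
  have := cpsi 0; rewrite /continuous_at (flow0 Fpsi).
  by move=> /(_ _ (filterI uniq (exi d d0))).
have /nbhs_normP[sigma /= sigma0 Hs] := near_y.
have {}Hs s : `|s| < sigma -> (forall t t', `|t| < d -> `|t'| < d ->
      S (phi t (psi s y)) -> S (phi t' (psi s y)) -> t = t') /\
    exists2 t, `|t| < d & S (phi t (psi s y)).
  by move=> ss; apply: Hs; rewrite /= sub0r normrN.
have /choice[theta Ht] s : exists t, `|s| < sigma ->
    `|t| < d /\ S (phi t (psi s y)).
  have [ss|_] := boolP (`|s| < sigma); last by exists 0.
  by have [_ [t td St]] := Hs s ss; exists t.
exists sigma, theta; split => //.
- have s0 : `|0 : R| < sigma by rewrite normr0.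
  have [t0 S0] := Ht 0 s0; have [U0 _] := Hs 0 s0.
  by apply: U0 => //; rewrite ?normr0// (flow0 Fpsi) (flow0 Fphi).
- by move=> s /Ht[].
move=> s0 s0s; have [td St] := Ht s0 s0s.
apply/cvgrPdist_lt => e e0.
pose q0 := phi (theta s0) (psi s0 y).
have Yq0 : Y q0 != 0 by apply: contra Y0 => /eqP/zero_flow ->.
have [_ _ [_ exi0]] := T q0 St Yq0.
(* The second term keeps [t + theta s0] in the window where crossing times are unique. *)
pose d' := Num.min e (d - `|theta s0|).
have d'0 : 0 < d' by rewrite lt_min e0 subr_gt0.
have cq : {for s0, continuous (fun s => phi (theta s0) (psi s y))}.
  by apply: (@pair_cvg (cst (theta s0)) id); [exact: cvg_cst|exact: cvg_id].
have ns : \forall s \near s0, `|s| < sigma.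
  have := @near_norm_lt R R^o s0 0 sigma; rewrite subr0 => /(_ s0s).
  by apply: filterS => s; rewrite subr0.
have nq : \forall s \near s0,
    exists2 t, `|t| < d' & S (phi t (phi (theta s0) (psi s y))).
  exact: (cq _ (exi0 d' d'0)).
have H : \forall s \near s0, `|s| < sigma /\
    exists2 t, `|t| < d' & S (phi t (phi (theta s0) (psi s y))) by exact: filterI.
move: H; apply: filterS => s [ss [t + St']].
rewrite lt_min => /andP[te tdd].
have [U1 _] := Hs s ss; have [t1 S1] := Ht s ss.
rewrite -(U1 (t + theta s0) (theta s)) //.
- by rewrite opprD addrCA subrr addr0 normrN.
- by have := ler_normD t (theta s0); lra.
- by rewrite (flowD CY Fphi).
Qed.

(** Here [psi s y = phi (- theta s) y], so [s X] and [- theta s Y] agree at [y] up to a small error.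
    Since [theta] is only continuous, the quotient [theta s / s] is not given a limit but a bound,
    enough to make every minor of [X] and [Y] arbitrarily small. *)
Lemma orbit_collinear y sigma theta : 0 < sigma -> Y y != 0 -> theta 0 = 0 ->
  {for 0, continuous theta} ->
  (forall s : R, `|s| < sigma -> phi (theta s) (psi s y) = y) ->
  exists c, collinear X Y c y.
Proof.
move=> sigma0 Y0 th0 cth H; set v := X y; set w := Y y.
have [k wk] : exists k, w 0 k != 0.
  apply: contrapT => Hk; move/eqP: Y0; apply; apply/rowP => k; rewrite mxE.
  by apply: contrapT => /eqP wk; apply: Hk; exists k.
have aa := chart_at_atlas y; have ay := chart_at_dom y; set a := chart_at y in aa ay.
have Dx : is_derive (0 : R) (1 : R) (coord a \o psi^~ y) v.
  have := flow_line_derive (flow_flow_line Fpsi y) (t := 0) aa.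
  by rewrite (flow0 Fpsi) field_inE// push_chart_at; apply.
have Dy : is_derive (0 : R) (1 : R) (coord a \o phi^~ y) w.
  have := flow_line_derive (flow_flow_line Fphi y) (t := 0) aa.
  by rewrite (flow0 Fphi) field_inE// push_chart_at; apply.
have W0 : 0 < `|w 0 k| by rewrite normr_gt0.
(* Bound of [|theta s| / |s|], read on a component [k] where [Y] does not vanish; requiring
   [eps <= |w 0 k| / 2] lets the error in [theta s] be absorbed. *)
pose A := 2 / `|w 0 k| * (`|v| + `|w 0 k|).
have A0 : 0 <= A by rewrite mulr_ge0// ?divr_ge0// addr_ge0.
suff minor j : v 0 j * w 0 k = w 0 j * v 0 k.
  exists (v 0 k / w 0 k); apply/rowP => j; rewrite mxE -/v -/w.
  by apply: (mulIf wk); rewrite minor mulrAC divfK// mulrC.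
apply/eqP; rewrite -subr_eq0 -normr_le0; apply/ler_addgt0Pr => e e0; rewrite add0r.
(* Each minor combines two components of the error [eps * (1 + A) * |s|], weighted by entries of
   [w]; the added 1 keeps [D] positive even without using [w != 0]. *)
pose D := 2 * (`|w| + 1) * (1 + A).
have A1 : 0 < 1 + A by rewrite ltr_pwDl.
have w1 : 0 < `|w| + 1 by rewrite ltr_wpDl.
have D0 : 0 < D by rewrite !mulr_gt0.
pose eps := Num.min (e / D) (`|w 0 k| / 2).
have eps0 : 0 < eps by rewrite lt_min !divr_gt0.
have nx := is_derive_littleo Dx eps0.
have ny := is_derive_littleo Dy eps0.
have cth' : {for 0, continuous (fun s => - theta s)}.
  exact: (continuousN cth).
have ny' : \forall s \near (0 : R),
    `|(coord a \o phi^~ y) (0 + - theta s) - (coord a \o phi^~ y) 0 -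
      (- theta s) *: w| <= eps * `|- theta s|.
  by have := cth'; rewrite /prop_for /continuous_at th0 oppr0 => /(_ _ ny).
have /nbhs_normP[r /= r0 Hr] : \forall s \near (0 : R), [/\ `|s| < sigma,
    `|(coord a \o psi^~ y) (0 + s) - (coord a \o psi^~ y) 0 - s *: v| <= eps * `|s| &
    `|(coord a \o phi^~ y) (0 + - theta s) - (coord a \o phi^~ y) 0 -
      (- theta s) *: w| <= eps * `|- theta s| ].
  have ns : \forall s \near (0 : R), `|s| < sigma.
    have := @near_norm_lt R R^o 0 0 sigma; rewrite subr0 normr0 => /(_ sigma0).
    by apply: filterS => s; rewrite subr0.
  near=> s; split; near: s; [exact: ns|exact: nx|exact: ny'].
pose s := r / 2.
have s0 : 0 < s by rewrite divr_gt0.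
have [|ss] := Hr s; first by rewrite /= sub0r normrN gtr0_norm// /s; lra.
pose tau := - theta s; rewrite -/tau !add0r /= (flow0 Fpsi) (flow0 Fphi).
have -> : psi s y = phi tau y.
  by rewrite -{2}(H s ss) -(flowD CY Fphi) addNr (flow0 Fphi).
set z := coord a _; set z0 := coord a _ => hx hy.
have key : `|s *: v - tau *: w| <= eps * (`|s| + `|tau|).
  have -> : s *: v - tau *: w = (z - z0 - tau *: w) - (z - z0 - s *: v).
    by apply/rowP => i; rewrite !mxE; ring.
  by apply: le_trans (ler_normB _ _) _; rewrite mulrDr addrC lerD.
have keyj i : `|s * v 0 i - tau * w 0 i| <= eps * (`|s| + `|tau|).
  by apply: le_trans key; have := entry_norm (s *: v - tau *: w) i; rewrite !mxE.
have epsw : eps <= `|w 0 k| / 2 by rewrite ge_min lexx orbT.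
have epse : eps <= e / D by rewrite ge_min lexx.
have tauA : `|tau| <= A * `|s|.
  have h1 : `|tau| * `|w 0 k| <= `|s| * `|v 0 k| + eps * (`|s| + `|tau|).
    rewrite -normrM -normrM.
    have -> : tau * w 0 k = s * v 0 k - (s * v 0 k - tau * w 0 k) by rewrite subKr.
    by apply: le_trans (ler_normB _ _) _; rewrite lerD2l.
  have vk := entry_norm v k.
  have sp : 0 <= `|s| by []; have tp : 0 <= `|tau| by [].
  have -> : A * `|s| = 2 * (`|v| + `|w 0 k|) * `|s| / `|w 0 k|.
    by rewrite /A; field; rewrite gt_eqF.
  rewrite ler_pdivlMr//.
  have : `|s| * `|v 0 k| <= `|s| * `|v| by rewrite ler_wpM2l.
  have : eps * (`|s| + `|tau|) <= `|w 0 k| / 2 * (`|s| + `|tau|).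
    by rewrite ler_wpM2r// addr_ge0.
  have : 0 <= `|w 0 k| * `|s| by rewrite mulr_ge0.
  lra.
have wj := entry_norm w j; have wk' := entry_norm w k.
have : `|s| * `|v 0 j * w 0 k - w 0 j * v 0 k| <= `|s| * e.
  rewrite -normrM.
  have -> : s * (v 0 j * w 0 k - w 0 j * v 0 k) =
    w 0 k * (s * v 0 j - tau * w 0 j) - w 0 j * (s * v 0 k - tau * w 0 k) by ring.
  apply: le_trans (ler_normB _ _) _; rewrite (normrM (w 0 k)) (normrM (w 0 j)).
  have B0 : 0 <= eps * (`|s| + `|tau|) by rewrite mulr_ge0 ?addr_ge0// ltW.
  have b1 : `|w 0 k| * `|s * v 0 j - tau * w 0 j| <=
      (`|w| + 1) * (eps * (`|s| + `|tau|)).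
    by apply: ler_pM => //; apply: le_trans wk' _; rewrite lerDl.
  have b2 : `|w 0 j| * `|s * v 0 k - tau * w 0 k| <=
      (`|w| + 1) * (eps * (`|s| + `|tau|)).
    by apply: ler_pM => //; apply: le_trans wj _; rewrite lerDl.
  apply: le_trans (lerD b1 b2) _.
  have b3 : eps * (`|s| + `|tau|) <= eps * ((1 + A) * `|s|).
    by apply: ler_wpM2l; [exact: ltW|rewrite mulrDl mul1r lerD2l].
  have b4 : eps * D <= e by rewrite -ler_pdivlMr.
  have b5 : (`|w| + 1) * (eps * (`|s| + `|tau|)) <= (`|w| + 1) * (eps * ((1 + A) * `|s|)).
    by apply: ler_wpM2l => //; rewrite addr_ge0.
  apply: le_trans (lerD b5 b5) _.
  have -> : (`|w| + 1) * (eps * ((1 + A) * `|s|)) +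
    (`|w| + 1) * (eps * ((1 + A) * `|s|)) = `|s| * (eps * D) by rewrite /D; ring.
  by apply: ler_wpM2l.
by rewrite ler_pM2l// normr_gt0 gt_eqF.
Unshelve. all: by end_near. Qed.

End SectionPath.

(** * Holonomy between the sections *)

Section LeafCoords.
Context {R : realType} {n : nat} {M : manifold R n}.

(** The inverse of a product parametrization: the second component is the parameter of the leaf, the
    first a coordinate along it. *)
Definition leaf_coords (eps : R) (L : R -> set M) (S : set M)
    (k : M -> R * R) : Prop :=
  [/\ {within S, continuous k}, set_inj S k &
    forall y, S y -> `|(k y).2| < eps /\
      forall c, `|c| < eps -> (L c y <-> (k y).2 = c)].

Lemma trivially_foliated_coords eps L (S : set M) :
  trivially_foliated eps L S -> exists k, leaf_coords eps L S k.
Proof.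
move=> [h [[_ hinj hopen] -> HL]].
set D := [set u : R * R | `|u.1| < 1 /\ `|u.2| < eps] in hinj hopen HL *.
have /choice[k Hk] y : exists u, (h @` D) y -> D u /\ h u = y.
  have [[u Du <-]|] := pselect ((h @` D) y); first by exists u.
  by move=> H; exists (0, 0) => /H.
have kh u : D u -> k (h u) = u.
  move=> Du; have [|Dk hk] := Hk (h u); first by exists u.
  by apply: hinj; rewrite ?inE.
exists k; split.
- apply/subspace_continuousP => _ [u Du <-]; rewrite /from_subspace kh// => P nP.
  have [Q [oQ Qu] QP] : exists2 Q : set (R * R), open_nbhs u Q & Q `<=` P.
    by move: nP; rewrite nbhsE => -[Q oQ QP]; exists Q.
  have [Q' oQ' EQ] := hopen Q oQ.
  have nQ' : nbhs (h u) Q'.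
    apply: open_nbhs_nbhs; split => //.
    have : (h @` (Q `&` D)) (h u) by exists u.
    by rewrite EQ => -[].
  apply: filterS nQ' => y Q'y Dy /=.
  have : (h @` (Q `&` D)) y by rewrite EQ.
  by move=> [v [Qv Dv] <-]; rewrite kh//; exact: QP.
- move=> y y' /set_mem Sy /set_mem Sy' E.
  by have [_ <-] := Hk y Sy; have [_ <-] := Hk y' Sy'; rewrite E.
move=> y Sy; have [[k1 k2] hk] := Hk y Sy; split => // c ce; split => [Ly|kc].
  have : (h @` D `&` L c) y by [].
  rewrite HL// => -[u [u1 u2] hu].
  suff -> : k y = u by [].
  by rewrite -hu kh//; split => //; rewrite u2.
have : (h @` [set u | `|u.1| < 1 /\ u.2 = c]) y by exists (k y).
by rewrite -HL// => -[].
Qed.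

End LeafCoords.

Section Holonomy.
Context {R : realType} {n : nat} {M : manifold R n}.
Variables (X Y : M -> 'rV[R]_n) (psi phi : R -> M -> M).
Hypotheses (CX : Ck_field 3 X) (CY : Ck_field 3 Y).
Hypotheses (Fpsi : is_flow X psi) (Fphi : is_flow Y phi) (XY : commuting X Y).
Variable eps : R.

(** What the argument retains of local stable and unstable manifolds, so that both foliations are
    treated alike. *)
Definition regular_leaves (W : R -> set M) : Prop := forall c y,
  `|c| < eps -> W c y ->
  [/\ \forall d \near 0^'+, forall a b : R, `|a| < d -> `|b| < d ->
        W c (phi a (psi b y)),
      forall c', collinear X Y c' y -> c' = c & Y y != 0].

Variables (W1 W2 : R -> set M) (S1 S2 O : set M) (k1 k2 : M -> R * R).
Hypotheses (rW1 : regular_leaves W1) (rW2 : regular_leaves W2).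
Hypothesis T1 : forall q, S1 q -> Y q != 0 -> transversal_at phi S1 q.
Hypotheses (K1 : leaf_coords eps W1 S1 k1) (K2 : leaf_coords eps W2 S2 k2).
Hypothesis oO : open O.
Let V := O `&` S1.
Variable tau : M -> R.
Hypothesis ctau : {within V, continuous tau}.
Let hol y := phi (tau y) y.
Hypothesis hol_S2 : forall y, V y -> S2 (hol y).

Lemma tau_cvg (y : M) (e : R) : V y -> 0 < e ->
  \forall z \near y, V z -> `|tau z - tau y| < e.
Proof.
move=> Vy e0.
have /cvgrPdist_lt/(_ e e0) := (subspace_continuousP _ _).1 ctau y Vy.
rewrite /from_subspace => H.
have {}H : \forall z \near y, V z -> `|tau y - tau z| < e by exact: H.
by apply: filterS H => z Hz Vz; rewrite distrC; exact: Hz.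
Qed.

Lemma hol_cvg (y : M) (Q : set M) : V y -> nbhs (hol y) Q ->
  \forall z \near y, V z -> Q (hol z).
Proof.
move=> Vy nQ; have := flow_continuous CY Fphi (x := (tau y, y)).
rewrite /continuous_at /= => /(_ _ nQ) [[A B] /= [Ay By] HAB].
have /nbhs_normP[e /= e0 He] := Ay.
apply: filterS2 By (tau_cvg Vy e0) => z Bz Hz Vz.
by apply: (HAB (tau z, z)); split => //; apply: He; rewrite /= distrC; exact: Hz.
Qed.

(** The [psi]-orbit of [y], projected to [S1] along [phi], stays in the leaf [W1 c]. Its holonomy
    image differs from [hol y] by short times of both flows, because they commute, so it stays in
    one leaf of [W2]. *)
Lemma noncollinear_arc c y : `|c| < eps -> (V `&` W1 c) y ->
  ~ (exists c', collinear X Y c' y) ->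
  exists C, [/\ C `<=` V `&` W1 c, connected C,
    forall z, C z -> (k2 (hol z)).2 = (k2 (hol y)).2 &
    exists p q, [/\ C p, C q & p <> q]].
Proof.
move=> ce [[Oy Sy] Wy] nc.
have Vy : V y by [].
have [near1 _ Y0] := rW1 ce Wy.
have [sigma [theta [sigma0 th0 Sth cth]]] := section_path CX CY Fpsi Fphi XY Sy Y0 T1.
pose rho s := phi (theta s) (psi s y).
have rho0 : rho 0 = y by rewrite /rho th0 (flow0 Fpsi) (flow0 Fphi).
have crho s : `|s| < sigma -> {for s, continuous rho}.
  by move=> ss; apply: (pair_cvg CY Fpsi Fphi (cth s ss)); exact: cvg_id.
have s00 : `|0 : R| < sigma by rewrite normr0.
have c0 := crho 0 s00; rewrite /prop_for /continuous_at rho0 in c0.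
have ct0 := cth 0 s00; rewrite /prop_for /continuous_at th0 in ct0.
pose x := hol y; pose c' := (k2 x).2.
have S2x : S2 x by exact: hol_S2.
have [_ _ /(_ x S2x)[c'e LK]] := K2.
have W2x : W2 c' x by apply/(LK c' c'e).
have [near2 _ _] := rW2 c'e W2x.
have /filter_ex[d [[d0 H1] H2]] : \forall d \near 0^'+, (0 < d /\
    (forall a b : R, `|a| < d -> `|b| < d -> W1 c (phi a (psi b y)))) /\
    (forall a b : R, `|a| < d -> `|b| < d -> W2 c' (phi a (psi b x))).
  by apply: filterI => //; apply: filterI => //; exact: nbhs_right_gt.
(* The crossing time and the variation of [tau] add up in the time applied to [x]; each is allowed
   one half. *)
have d20 : 0 < d / 2 by rewrite divr_gt0.
have nO : \forall s \near (0 : R), O (rho s).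
  by apply: c0; apply: open_nbhs_nbhs.
have nth : \forall s \near (0 : R), `|theta s| < d / 2.
  have /cvgrPdist_lt/(_ _ d20) := ct0.
  by apply: filterS => s; rewrite sub0r normrN.
have nt : \forall s \near (0 : R), V (rho s) -> `|tau (rho s) - tau y| < d / 2.
  exact: (c0 _ (tau_cvg Vy d20)).
have ns (r : R) : 0 < r -> \forall s \near (0 : R), `|s| < r.
  move=> r0; have := @near_norm_lt R R^o 0 0 r; rewrite subr0 normr0 => /(_ r0).
  by apply: filterS => s; rewrite subr0.
have /nbhs_normP[s' /= s'0 Hs'] : \forall s \near (0 : R),
    [/\ `|s| < sigma, `|s| < d, O (rho s), `|theta s| < d / 2 &
     V (rho s) -> `|tau (rho s) - tau y| < d / 2].
  near=> s; split; near: s; [exact: ns|exact: ns|exact: nO|exact: nth|exact: nt].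
have {}Hs' s : `|s| < s' -> [/\ `|s| < sigma, `|s| < d, O (rho s),
    `|theta s| < d / 2 & V (rho s) -> `|tau (rho s) - tau y| < d / 2].
  by move=> ss; apply: Hs'; rewrite /= sub0r normrN.
have Vrho s : `|s| < s' -> V (rho s).
  by move=> /Hs'[ss _ Os _ _]; split => //; exact: Sth.
have in_itv s : `](- s'), s'[%classic s <-> `|s| < s'.
  by rewrite /= in_itv /= ltr_norml.
exists (rho @` `](- s'), s'[%classic); split.
- move=> _ [s /in_itv ss <-]; split; first exact: Vrho.
  by have [_ sd _ td _] := Hs' s ss; apply: H1 => //; lra.
- apply: connected_continuous_connected; first exact/connected_intervalP/interval_is_interval.
  apply: continuous_in_subspaceT => s /set_mem/in_itv ss.
  by apply: crho; have [] := Hs' s ss.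
- move=> _ [s /in_itv ss <-]; have [_ sd _ td /(_ (Vrho s ss)) taud] := Hs' s ss.
  have [_ _ /(_ _ (hol_S2 (Vrho s ss)))[_ LKs]] := K2.
  apply/(LKs _ c'e).
  have -> : hol (rho s) = phi (tau (rho s) - tau y + theta s) (psi s x).
    rewrite /hol /x /hol (flows_commute CX CY Fpsi Fphi XY).
    rewrite -!(flowD CY Fphi); congr (phi _ _); ring.
  apply: H2 => //; apply: le_lt_trans (ler_normD _ _) _; lra.
exists y.
(* A path that never left [y] would make [y] collinear. *)
have [s ss Hrho] : exists2 s, `|s| < s' & rho s <> y.
  apply: contrapT => H; apply: nc.
  apply: (orbit_collinear CY Fpsi Fphi s'0 Y0 th0 (cth 0 s00)) => s ss.
  by apply: contrapT => Hs; apply: H; exists s.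
exists (rho s); split; last by move/esym.
  by exists 0 => //; apply/in_itv; rewrite normr0.
by exists s => //; exact/in_itv.
Unshelve. all: by end_near. Qed.

Lemma W1_coord c y : `|c| < eps -> V y -> W1 c y -> (k1 y).2 = c.
Proof. by move=> ce [_ Sy]; have [_ _ /(_ y Sy)[_ /(_ c ce) ->]] := K1. Qed.

(* Constancy along the arc: at a collinear point both leaf parameters agree
   with the collinearity factor, elsewhere the arc is locally an orbit. *)
Lemma holonomy_leaf c y0 : `|c| < eps -> connected (V `&` W1 c) ->
  (V `&` W1 c) y0 -> collinear X Y c y0 ->
  forall y, (V `&` W1 c) y -> W2 c (hol y).
Proof.
move=> ce cA Ay0 Zy0.
have leaf2 c' y : V y -> collinear X Y c' y -> (k2 (hol y)).2 = c'.
  move=> Vy Zy; have S2y := hol_S2 Vy.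
  have [_ _ /(_ _ S2y)[c2e /(_ _ c2e)[_ /(_ erefl) W2y]]] := K2.
  have [_ uniq _] := rW2 c2e W2y.
  exact/esym/uniq/(collinear_flow CX CY Fphi XY).
have ck1 : {within V `&` W1 c, continuous (fun y => (k1 y).1)}.
  apply/subspace_continuousP => y [Vy _].
  have [ck1 _ _] := K1.
  have H := (subspace_continuousP _ _).1 ck1 y Vy.2.
  have {}H : k1 z @[z --> within (V `&` W1 c) (nbhs y)] --> k1 y.
    by apply: cvg_trans H; apply: cvg_app; apply: within_subset => z [[]].
  exact: (cvg_comp _ _ H cvg_fst).
have cf : {within V `&` W1 c, continuous (fun y => (k2 (hol y)).2)}.
  apply/subspace_continuousP => y [Vy _] P nP.
  have [ck2 _ _] := K2.
  have H := (subspace_continuousP _ _).1 ck2 _ (hol_S2 Vy).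
  have H2 : (k2 z).2 @[z --> within S2 (nbhs (hol y))] --> (k2 (hol y)).2.
    exact: (cvg_comp _ _ H cvg_snd).
  have := H2 _ nP => H3.
  apply: filterS (hol_cvg Vy H3) => z Hz [Vz _].
  exact: (Hz Vz (hol_S2 Vz)).
have inj1 : set_inj (V `&` W1 c) (fun y => (k1 y).1).
  move=> y y' /set_mem[Vy Wy] /set_mem[Vy' Wy'] E.
  have [_ inj _] := K1; apply: inj; [exact/mem_set/Vy.2|exact/mem_set/Vy'.2|].
  rewrite (surjective_pairing (k1 y)) (surjective_pairing (k1 y')).
  by rewrite E (W1_coord ce Vy Wy) (W1_coord ce Vy' Wy').
have H y : (V `&` W1 c) y -> (k2 (hol y)).2 <> c -> exists C,
    [/\ C `<=` V `&` W1 c, connected C,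
      forall z, C z -> (k2 (hol z)).2 = (k2 (hol y)).2 &
      exists p q, [/\ C p, C q & p <> q]].
  move=> Ay fy; apply: (noncollinear_arc ce Ay) => -[c' Zy].
  have [_ uniq _] := rW1 ce Ay.2.
  by apply: fy; rewrite -(uniq _ Zy); exact: leaf2 Ay.1 Zy.
move=> y Ay; have E := constant_on_arc cA ck1 cf inj1 Ay0 (leaf2 _ _ Ay0.1 Zy0) H Ay.
have [_ _ /(_ _ (hol_S2 Ay.1))[_ /(_ _ ce)[_]]] := K2.
by apply; exact: E.
Qed.

(** If the arc were sent to one point, it would lie on a single flow line, crossed at times given by
    differences of [tau]. These fill an interval, against uniqueness of short crossing times of the
    section. *)
Lemma hol_not_constant c : `|c| < eps -> connected (V `&` W1 c) ->
  (exists p q, [/\ (V `&` W1 c) p, (V `&` W1 c) q & p <> q]) ->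
  exists p q, [/\ (hol @` (V `&` W1 c)) p, (hol @` (V `&` W1 c)) q & p <> q].
Proof.
move=> ce cA [p [q [Ap Aq pq]]]; apply: contrapT => H.
have Hc y : (V `&` W1 c) y -> hol y = hol p.
  move=> Ay; apply: contrapT => Hy; apply: H.
  by exists (hol y), (hol p).
have orb y : (V `&` W1 c) y -> y = phi (tau p - tau y) p.
  move=> Ay; rewrite addrC (flowD CY Fphi) -[phi (tau p) p]/(hol p) -(Hc _ Ay).
  by rewrite /hol -(flowD CY Fphi) addNr (flow0 Fphi).
have ctA : {within V `&` W1 c, continuous tau}.
  by apply: continuous_subspaceW ctau => z [].
have /connected_intervalP itv := connected_continuous_connected cA ctA.
have tpq : tau q != tau p.
  apply/eqP => E; apply: pq; have := orb q Aq.
  by rewrite E subrr (flow0 Fphi) => ->.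
have [_ _ Y0] := rW1 ce Ap.2.
have [d d0 [/nbhs_singleton uniq _]] := T1 Ap.1.2 Y0.
(* [tau q] clamped to within [d / 2] of [tau p]: still different from [tau p], still between the two
   values, and inside the window [d]. *)
pose t := Num.max (tau p - d / 2) (Num.min (tau q) (tau p + d / 2)).
have td : `|tau p - t| < d.
  by rewrite /t ltr_norml;
    case: (leP (tau q) (tau p + d / 2)) => ?;
    case: (leP (tau p - d / 2)) => ?; apply/andP; split; lra.
have tp : t != tau p.
  by move: tpq; rewrite /t neq_lt => /orP[?|?]; rewrite neq_lt;

    case: (leP (tau q) (tau p + d / 2)) => ?;
    case: (leP (tau p - d / 2)) => ?; apply/orP; (left; lra) || (right; lra).
have [y Ay ty] : (tau @` (V `&` W1 c)) t.
  have [qp|qp|E] := ltgtP (tau q) (tau p); last by rewrite E eqxx in tpq.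
    apply: (itv (tau q) (tau p)); [by exists q|by exists p|].
    by rewrite /t;
    case: (leP (tau q) (tau p + d / 2)) => ?;
    case: (leP (tau p - d / 2)) => ?; apply/andP; split; lra.
  apply: (itv (tau p) (tau q)); [by exists p|by exists q|].
  by rewrite /t;
    case: (leP (tau q) (tau p + d / 2)) => ?;
    case: (leP (tau p - d / 2)) => ?; apply/andP; split; lra.
have Sy := Ay.1.2; rewrite (orb y Ay) ty in Sy.
have := uniq (tau p - t) 0 td; rewrite normr0 (flow0 Fphi) => /(_ d0 Sy Ap.1.2).
by move/eqP; rewrite subr_eq0 eq_sym (negbTE tp).
Qed.

Lemma holonomy_segment c y0 : `|c| < eps ->
  segment_of (S1 `&` W1 c) (V `&` W1 c) ->
  (V `&` W1 c) y0 -> collinear X Y c y0 ->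
  segment_of (S2 `&` W2 c) (hol @` (V `&` W1 c)).
Proof.
move=> ce [_ cA two] Ay0 Zy0; split.
- move=> _ [y Ay <-]; split; first exact: hol_S2 Ay.1.
  exact: holonomy_leaf ce cA Ay0 Zy0 y Ay.
- apply: connected_continuous_connected => //.
  apply/subspace_continuousP => y [Vy _] P nP.
  by apply: filterS (hol_cvg Vy nP) => z Hz [Vz _]; exact: Hz.
exact: hol_not_constant ce cA two.
Qed.

(* A collinear point close to [x] reaches [V] along the flow of [Y]. *)
Lemma collinear_on_leaves (Kc : R -> set M) x : V x -> Y x != 0 ->
  (forall y, V y -> exists2 c, `|c| < eps & W1 c y) ->
  (forall c p, Kc c p -> collinear X Y c p) -> Kc 0 x ->
  (forall U, open U -> Kc 0 `&` U !=set0 ->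
    \forall c \near (0 : R), Kc c `&` U !=set0) ->
  \forall c \near (0 : R), exists2 y, (V `&` W1 c) y & collinear X Y c y.
Proof.
move=> [Ox Sx] Y0 VW KZ Kx near_Kc.
have [_ _ [_ exi]] := T1 Sx Y0.
have := flow_continuous CY Fphi (x := (0, x)); rewrite /continuous_at /= (flow0 Fphi).
move=> /(_ _ (open_nbhs_nbhs (conj oO Ox))) [[A B] /= [A0 Bx] HAB].
have /nbhs_normP[d /= d0 Hd] := A0.
pose N := interior (B `&` [set p | exists2 t, `|t| < d & S1 (phi t p)]).
have Nx : N x by apply: filterI Bx (exi d d0).
have : Kc 0 `&` N !=set0 by exists x.
move=> /(near_Kc _ (@open_interior _ _)); apply: filterS => c [p [Kp]].
move=> /interior_subset[Bp [t td St]].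
exists (phi t p); last exact: (collinear_flow CX CY Fphi XY _ (KZ _ _ Kp)).
have Vp : V (phi t p).
  split => //; apply: (HAB (t, p)); split => //; apply: Hd.
  by rewrite /= sub0r normrN.
(* The point lies on some leaf [c']; regularity of the leaf forces [c'] to be the collinearity
   factor. *)
split => //; have [c' c'e Wp] := VW _ Vp.
have [_ uniq _] := rW1 c'e Wp.
by rewrite (uniq c (collinear_flow CX CY Fphi XY _ (KZ _ _ Kp))).
Qed.

End Holonomy.

(** * Regularity of local stable and unstable manifolds *)

Section LocalStableLeaves.
Context {R : realType} {n : nat} {M : manifold R n}.
Variables (X Y : M -> 'rV[R]_n) (psi phi : R -> M -> M).
Hypotheses (CX : Ck_field 3 X) (CY : Ck_field 3 Y).
Hypotheses (Fpsi : is_flow X psi) (Fphi : is_flow Y phi) (XY : commuting X Y).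

Lemma reverse_continuous : continuous (fun z : R * M => reverse phi z.1 z.2).
Proof.
move=> [t p]; apply: (@continuous_comp _ (R * M)%type M (fun z : R * M => (- z.1, z.2))
  (fun z => phi z.1 z.2)); last exact: (flow_continuous CY Fphi).
have c1 : (- z.1) @[z --> (t, p)] --> - t by apply: (@cvgN _ R^o); exact: cvg_fst.
exact: (cvg_pair c1 cvg_snd).
Qed.

(* [sg] is the identity for the flow [phi], and [-%R] for the reversed flow. *)
Lemma local_stable_regular (Phi : R -> M -> M) (sg : R -> R) (c : R)
    (gamma W : set M) :
  (forall a, `|sg a| = `|a|) -> (forall a, phi a = Phi (sg a)) ->
  (forall a, Phi a = phi (sg a)) ->
  continuous (fun z : R * M => Phi z.1 z.2) ->
  (forall s t p, Phi (t + s) p = Phi t (Phi s p)) ->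
  periodic_orbit Y setT gamma ->
  (forall p, gamma p -> collinear X Y c p /\ Y p != 0) ->
  local_stable Phi gamma W -> forall y, W y ->
  [/\ \forall d \near 0^'+, forall a b : R, `|a| < d -> `|b| < d ->
        W (phi a (psi b y)),
      forall c', collinear X Y c' y -> c' = c & Y y != 0].
Proof.
move=> sgn phiE PhiE cPhi PhiD pg gZ [_ _ [V [oV gV ->]]] y Wy.
have [cg ginv] := periodic_orbit_flow CY Fphi pg.
have closedness Q : closed Q -> (forall t, Q (phi t y)) -> exists2 p, gamma p & Q p.
  move=> cQ Qy; apply: (basin_closed (V := V) Wy cQ) => t.
  by rewrite PhiE; exact: Qy.
split.
- have Phi0 p : Phi 0 p = p.
    have -> : Phi 0 = phi 0; last exact: flow0 Fphi p.
    rewrite PhiE; congr phi; apply/eqP; rewrite -normr_eq0 sgn normr0//.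
  have Phi_psi s t p : psi s (Phi t p) = Phi t (psi s p).
    by rewrite PhiE; exact: (flows_commute CX CY Fpsi Fphi XY).
  have := @basin_invariant _ _ _ Phi psi cPhi (flow_continuous CX Fpsi) Phi0
    (flow0 Fpsi) PhiD Phi_psi V gamma y oV gV cg _ _ Wy.
  move=> H; apply: filterS (H _ _) => [d Hd a b ad bd|a p gp|b p gp].
  + by rewrite phiE; apply: Hd => //; rewrite sgn.
  + by rewrite PhiE; exact: ginv.
  + rewrite (psi_collinear CX CY Fpsi Fphi XY _ (gZ p gp).1); exact: ginv.
- move=> c' Zy.
  have [p gp Zp] := closedness _ (closed_collinear CX CY (c := c'))
    (fun t => collinear_flow CX CY Fphi XY t Zy).
  have [Zp' Yp] := gZ p gp.
  have : (c' - c) *: Y p = 0 by rewrite scalerBl -Zp -Zp' subrr.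
  by move=> /eqP; rewrite scaler_eq0 (negbTE Yp) orbF subr_eq0 => /eqP.
(* A zero of [Y] is collinear for the pair [(Y, Y)] with factor 0, which by closedness would produce
   a zero on [gamma]. *)
apply/eqP => Y0.
have [|p gp] := closedness (collinear Y Y 0) (closed_collinear CY CY (c := 0)).
  move=> t; apply: (collinear_flow CY CY Fphi (fun _ _ _ _ => erefl)).
  by rewrite scale0r.
have [_ Yp] := gZ p gp.
by rewrite /collinear /= scale0r => /eqP; rewrite (negbTE Yp).
Qed.

End LocalStableLeaves.

(** Restricting the parameters must leave the domains relatively open in the section, as a covering
    family demands. *)
Lemma leaf_coords_open (R : realType) n (M : manifold R n) (eps e : R)
    (L : R -> set M) (S : set M) k : leaf_coords eps L S k ->
  exists2 O, open O & forall y, S y -> (O y <-> `|(k y).2| < e).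
Proof.
move=> [ck _ _].
exists (interior [set y | S y -> `|(k y).2| < e]); first exact: open_interior.
move=> y Sy; split; first by move=> /interior_subset; apply.
move=> ke; have H := (subspace_continuousP _ _).1 ck y Sy.
have H2 : (k z).2 @[z --> within S (nbhs y)] --> (k y).2.
  exact: (cvg_comp _ _ H cvg_snd).
have nb : \forall v \near (k y).2, `|v| < e.
  have := @near_norm_lt R R^o (k y).2 0 e; rewrite subr0 => /(_ ke).
  by apply: filterS => z; rewrite subr0.
exact: (H2 _ nb).
Qed.

Theorem lemma4p18 (R : realType) (M : manifold R 3) (g : M -> 'M[R]_3)
  (U : set M) (X Y : M -> 'rV[R]_3) (phi : R -> M -> M) (eps : R)
  (ns nu : nat)
  (Gs : 'I_ns -> 'rV[R]_2 -> M) (Gu : 'I_nu -> 'rV[R]_2 -> M)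
  (Ws : 'I_ns -> R -> set M) (Wu : 'I_nu -> R -> set M)
  (Ss : 'I_ns -> set M) (Su : 'I_nu -> set M)
  (B : 'I_nu -> set M)
  (nl : 'I_nu -> nat) (V : forall i : 'I_nu, 'I_(nl i) -> set M)
  (jl : forall i : 'I_nu, 'I_(nl i) -> 'I_ns)
  (tau : forall i : 'I_nu, 'I_(nl i) -> M -> R)
  (Y' := Yproj g X Y)
  (S := level g U X Y)
  (KK := Kc U X Y)
  (J := fun i => fundamental_domain phi (Wu i) (Su i) (B i))
  (hol := fun i (l : 'I_(nl i)) (x : M) => phi (tau i l x) x) :
  riemannian g ->
  C3_triple U X Y ->
  is_flow Y phi ->
  0 < eps ->
  prepared g U X Y eps ->
  orientable_on (normal_plane g Y) U ->
  orientable_on (level_tangent g X Y) U ->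
  morse_smale Y' (S 0) ->
  (forall gamma, periodic_orbit Y' (S 0) gamma -> gamma `<=` K U X ->
    exists2 x, (K U X `\` periodic_points Y' (closure U)) x &
      omega_is Y' (S 0) x gamma \/ alpha_is Y' (S 0) x gamma) ->
  (forall c : R, `|c| < eps -> connected (KK c)) ->
  periodic_family Gs eps (stable_orbit Y') KK S ->
  periodic_family Gu eps (unstable_orbit Y') KK S ->
  (forall c : R, `|c| < eps ->
    (forall j, periodic_orbit Y setT (circle (Gs j) c)) /\
    (forall i, periodic_orbit Y setT (circle (Gu i) c))) ->
  (forall (c : R) x, `|c| < eps -> KK c x ->
    (forall t, KK c (phi t x)) /\
    [\/ exists j, circle (Gs j) c x,
        exists i, circle (Gu i) c x |
        exists i j, alpha_limit (phi ^~ x) = circle (Gu i) c /\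
                    omega_limit (phi ^~ x) = circle (Gs j) c]) ->
  (forall (c : R) i j, `|c| < eps ->
    (exists x, [/\ KK c x, alpha_limit (phi ^~ x) = circle (Gu i) c &
                   omega_limit (phi ^~ x) = circle (Gs j) c]) <->
    (exists x, [/\ KK 0 x, alpha_limit (phi ^~ x) = circle (Gu i) 0 &
                   omega_limit (phi ^~ x) = circle (Gs j) 0])) ->
  stable_system g Y phi eps Gs Ws Ss ->
  stable_system g Y (reverse phi) eps Gu Wu Su ->
  (forall i, base_points U X Y phi (Wu i) (Su i) (B i)) ->
  (forall i, covering_family U X eps (Wu i) (Su i) (J i) (@V i)) ->
  (forall i l, {within V i l, continuous (tau i l)} /\
    forall x, V i l x -> Ss (jl i l) (hol i l x)) ->
  exists (eps' : R) (V' : forall i : 'I_nu, 'I_(nl i) -> set M),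
    [/\ 0 < eps' <= eps,
        (forall i l, V' i l `<=` V i l),
        (forall i, covering_family U X eps' (Wu i) (Su i) (J i) (@V' i)) &
        forall i l (c : R), `|c| < eps' ->
          segment_of (Ss (jl i l) `&` Ws (jl i l) c)
            (hol i l @` (V' i l `&` Wu i c))].
Proof.
move=> rg [oU cU [CX CY [psi Fpsi] _ XY] YU XdU] Fphi eps0 prep _ _ _ _ _.
move=> [_ _ _ famS] [_ _ _ famU] perS _ _ stabS stabU _ cov tauP.
have [_ Yorth [_ contK] _] := prep.
(* The triple gives [Y != 0] on [U] only, while the periodic orbits lie in the closure; there,
   nonorthogonality to the levels excludes zeros. *)
have Ynz p : closure U p -> Y p != 0.
  move=> /Yorth[v _]; apply: contraNneq => ->; by rewrite /bil !mul0mx mxE.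
have circ N (G : 'I_N -> 'rV[R]_2 -> M) (stab : set M -> set M -> Prop) :
    (forall j c, `|c| < eps -> stab (S c) (circle (G j) c) /\
      circle (G j) c `<=` KK c) ->
    forall j c, `|c| < eps -> forall p, circle (G j) c p ->
      collinear X Y c p /\ Y p != 0.
  by move=> fam j c ce p /(fam j c ce).2[Up Zp]; split => //; exact: Ynz.
have regS j : regular_leaves X Y psi phi eps (Ws j).
  move=> c y ce; have [/(_ c ce) lst _ _ _] := stabS j.
  apply: (@local_stable_regular _ _ _ X Y psi phi CX CY Fpsi Fphi XY phi id c
    (circle (Gs j) c)) => //.
  - exact: flow_continuous CY Fphi.
  - exact: flowD CY Fphi.
  - by case: (perS c ce).
  - exact: circ famS j c ce.
have regU i : regular_leaves X Y psi phi eps (Wu i).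
  move=> c y ce; have [/(_ c ce) lst _ _ _] := stabU i.
  apply: (@local_stable_regular _ _ _ X Y psi phi CX CY Fpsi Fphi XY
    (reverse phi) -%R c (circle (Gu i) c)) => //.
  - by move=> a; rewrite normrN.
  - by move=> a; apply/funext => p; rewrite /reverse opprK.
  - exact: reverse_continuous CY Fphi.
  - by move=> s t p; rewrite /reverse opprD (flowD CY Fphi).
  - by case: (perS c ce).
  - exact: circ famU i c ce.
have trU i q : Su i q -> Y q != 0 -> transversal_at phi (Su i) q.
  have [_ _ [[e [Ce -> orth _]] _] _] := stabU i.
  by move=> [z _ <-]; exact: (section_transversal CY Fphi rg Ce orth (z0 := z)).
have /choice[kS KS] j : exists k, leaf_coords eps (Ws j) (Ss j) k.
  by have [_ _ _ /trivially_foliated_coords] := stabS j.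
have /choice[kU KU] i : exists k, leaf_coords eps (Wu i) (Su i) k.
  by have [_ _ _ /trivially_foliated_coords] := stabU i.
have zero i l : \forall c \near (0 : R),
    exists2 y, (V i l `&` Wu i c) y & collinear X Y c y.
  have [cov1 cov2 _ cov4 _] := cov i.
  have [D oD VE] := cov1 l.
  have [x [Vx [Jx [Ux Xx]]]] := cov2 l.
  rewrite VE in Vx *.
  apply: (collinear_on_leaves CX CY Fphi XY (regU i) (trU i) oD Vx (Kc := KK)).
  - exact: YU.
  - by move=> y; rewrite -VE => /cov4[c /= ce Wy]; exists c.
  - by move=> c p [].
  - by split; [exact: subset_closure|rewrite Xx scale0r].
  - exact: contK.
(* Both families are finite, so one bound on [|c|] serves for all holonomy maps. *)
have zeros i : \forall c \near (0 : R), forall l,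
    exists2 y, (V i l `&` Wu i c) y & collinear X Y c y.
  exact: filter_forall (zero i).
have /nbhs_normP[e /= e0 He] : \forall c \near (0 : R), forall i l,
    exists2 y, (V i l `&` Wu i c) y & collinear X Y c y.
  exact: filter_forall zeros.
pose eps' := Num.min e eps.
have e'0 : 0 < eps' by rewrite lt_min e0.
have e'e : eps' <= eps by rewrite ge_min lexx orbT.
(* Only leaves are discarded: each remaining arc [V i l]&[Wu i c] is kept whole, so its
   connectedness is inherited. *)
pose V' i l := V i l `&` \bigcup_(c in [set c | `|c| < eps']) Wu i c.
have V'W i l c : `|c| < eps' -> V' i l `&` Wu i c = V i l `&` Wu i c.
  move=> ce; apply/seteqP; split=> y [].
    by move=> [].
  by move=> Vy Wy; do 2?split => //; exists c.
(* Fundamental domains lie on the leaf of parameter 0, so the restriction loses none of their points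
   and the covering survives. *)
have J0 i y : J i y -> Wu i 0 y by move=> [b [q [_ _ [[_ ? ] _ _]]]].
exists eps', V'; split.
- by rewrite e'0.
- by move=> i l y [].
- move=> i; have [cov1 cov2 cov3 _ cov5] := cov i.
  have in0 y : J i y -> (\bigcup_(c in [set c | `|c| < eps']) Wu i c) y.
    by move=> Jy; exists 0; [rewrite /= normr0|exact: J0].
  split.
  + move=> l; have [D oD VE] := cov1 l.
    have [Q oQ HQ] := leaf_coords_open eps' (KU i).
    have [_ _ lc] := KU i.
    exists (D `&` Q); first exact: openI.
    apply/seteqP; split=> y.
      rewrite /V' VE => -[[Dy Sy] [c /= ce Wy]]; do 2?split => //.
      apply/(HQ y Sy); have [_ /(_ c (lt_le_trans ce e'e)) H] := lc y Sy.
      by rewrite (H.1 Wy).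
    move=> [[Dy Qy] Sy]; split; first by rewrite VE.
    have ke := (HQ y Sy).1 Qy; exists (kU i y).2 => //.
    by have [ke2 /(_ _ ke2)[_]] := lc y Sy; apply.
  + move=> l; have [x [Vx [Jx Kx]]] := cov2 l.
    by exists x; do 2?split => //; exact: in0.
  + move=> x [Jx Kx]; have [|l _ Vx] := cov3 x; first by [].
    by exists l => //; split => //; exact: in0.
  + by move=> l y [].
  + by move=> l c ce; rewrite V'W//; apply: cov5; exact: lt_le_trans e'e.
move=> i l c ce; rewrite V'W//.
have ce2 : `|c| < eps by exact: lt_le_trans e'e.
have [y0 Ay0 Zy0] : exists2 y, (V i l `&` Wu i c) y & collinear X Y c y.
  apply: He; rewrite /= sub0r normrN; apply: lt_le_trans ce _.
  by rewrite ge_min lexx.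
have [cov1 _ _ _ /(_ l c ce2) seg] := cov i.
have [ctau holS] := tauP i l.
have [D oD VE] := cov1 l.
rewrite VE in seg Ay0 ctau holS *.
exact: (holonomy_segment CX CY Fpsi Fphi XY (regU i) (regS (jl i l)) (trU i)
  (KU i) (KS (jl i l)) oD ctau holS ce2 seg Ay0 Zy0).
Qed.
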